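(* Let $(M,\mathcal{T},\varepsilon,\eta)$ be a weighted triangulated connected closed surface with weights $\varepsilon:V\to\{0,1\}$ and $\eta:E\to\mathbb{R}$ satisfying $$\varepsilon_s\varepsilon_t+\eta_{st}>0\quad\text{for every edge }\{st\}\in E,$$ and $$\varepsilon_q\eta_{st}+\eta_{qs}\eta_{qt}\ge 0,\quad \{q,s,t\}=\{i,j,k\},\quad\text{for every triangle }\{ijk\}\in F.$$ (a) A nondegenerate Euclidean discrete conformal factor $f:V\to\mathbb{R}$ on $(M,\mathcal{T},\varepsilon,\eta)$ is determined by its combinatorial curvature $K:V\to\mathbb{R}$ up to a vector $c(1,1,\dots,1)$, $c\in\mathbb{R}$; that is, if two nondegenerate Euclidean discrete conformal factors $f,f'$ have the same combinatorial curvature, then $f-f'=c(1,\dots,1)$ for some $c\in\mathbb{R}$. (b) A nondegenerate hyperbolic discrete conformal factor $f:V\to\mathbb{R}$ on $(M,\mathcal{T},\varepsilon,\eta)$ is determined by its combinatorial curvature $K:V\to\mathbb{R}$; that is, if two nondegenerate hyperbolic discrete conformal factors have the same combinatorial curvature, then they are equal.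
   Context: A triangulated closed surface $(M,\mathcal{T})$ is the quotient of a finite disjoint union of triangles by identifying all edges of the triangles in pairs by homeomorphisms; $V,E,F$ denote the sets of vertices, unoriented edges and faces (triangles). Vertices are written $i$, edges $\{ij\}$, triangles $\{ijk\}$; values of functions are written $\varepsilon_i,\eta_{ij}=\eta_{ji},f_i$. Given weights $\varepsilon:V\to\{0,1\}$, $\eta:E\to\mathbb{R}$ and $f:V\to\mathbb{R}$, the edge lengths are defined as follows. Euclidean background geometry: $l_{ij}=\sqrt{\varepsilon_ie^{2f_i}+\varepsilon_je^{2f_j}+2\eta_{ij}e^{f_i+f_j}}$. Hyperbolic background geometry: $l_{ij}=\cosh^{-1}\!\left(\sqrt{(1+\varepsilon_ie^{2f_i})(1+\varepsilon_je^{2f_j})}+\eta_{ij}e^{f_i+f_j}\right)$. (Under the assumed conditions on the weights these are well-defined and positive.) The function $f$ is a nondegenerate Euclidean (resp. hyperbolic) discrete conformal factor if, for every triangle $\{ijk\}\in F$, the lengths $l_{ij},l_{ik},l_{jk}$ satisfy the strict triangle inequalities, so that the triangle can be embedded in the Euclidean plane (resp. hyperbolic plane) as a nondegenerate triangle with these edge lengths. The combinatorial curvature of such an $f$ is $K_i=2\pi-\sum_{\{ijk\}\in F}\theta_i^{jk}$, where the sum is over triangles at $i$ and $\theta_i^{jk}$ is the inner angle at $i$ of the Euclidean (resp. hyperbolic) triangle $\{ijk\}$ with edge lengths $l_{ij},l_{ik},l_{jk}$ given by $l_{st}=\sqrt{\varepsilon_se^{2f_s}+\varepsilon_te^{2f_t}+2\eta_{st}e^{f_s+f_t}}$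 (resp. $l_{st}=\cosh^{-1}\!\left(\sqrt{(1+\varepsilon_se^{2f_s})(1+\varepsilon_te^{2f_t})}+\eta_{st}e^{f_s+f_t}\right)$) for each edge $\{st\}$ of the triangle. *)

(* Defs.v *)
From HB Require Import structures.
From mathcomp Require Import all_boot all_order all_algebra all_fingroup.
From mathcomp Require Import all_classical all_reals all_analysis.
From mathcomp Require Import ring lra.

Set Implicit Arguments.
Unset Strict Implicit.
Unset Printing Implicit Defensive.

Import Order.TTheory GRing.Theory Num.Theory.
Local Open Scope ring_scope.

(** The corners of each triangle are numbered by 'I_3, and the pair (t, a) in
    face * 'I_3 denotes either the corner a of t or the side of t opposite to
    that corner.  Up to isotopy, a homeomorphism between two sides is a
    bijection between their endpoints, and such a bijection extends uniquely to
    a permutation of 'I_3 that sends the corner opposite to the first side to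
    the corner opposite to the second one.  The side s of s.1 is glued to the
    side opposite to the corner [gperm s s.2] of [adj s], the endpoint b of s
    being glued to the endpoint [gperm s b].  Two sides of the same triangle may
    be glued, and loops, multiple edges and non-orientable surfaces are
    allowed. *)
Record triangulated_surface := TriangulatedSurface {
  face : finType;
  adj : face * 'I_3 -> face;
  gperm : face * 'I_3 -> 'S_3;
  adjK : forall s, adj (adj s, gperm s s.2) = s.1;
  gpermV : forall s, gperm (adj s, gperm s s.2) = (gperm s)^-1%g;
  glue_neq : forall s, (adj s, gperm s s.2) != s }.

Definition corner (S : triangulated_surface) : finType := (face S * 'I_3)%type.
Definition side (S : triangulated_surface) : finType := (face S * 'I_3)%type.

Definition glued (S : triangulated_surface) (s : side S) : side S :=
  (adj s, gperm s s.2).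

Lemma gluedK (S : triangulated_surface) : involutive (@glued S).
Proof. by case=> t a; rewrite /glued /= adjK gpermV /= permK. Qed.

Definition side_rel (S : triangulated_surface) : rel (side S) :=
  fun s s' => (s' == s) || (s' == glued s).

Lemma side_rel_refl (S : triangulated_surface) : reflexive (@side_rel S).
Proof. by move=> s; rewrite /side_rel eqxx. Qed.

Lemma side_rel_sym (S : triangulated_surface) : symmetric (@side_rel S).
Proof.
move=> s s'; rewrite /side_rel [s' == s]eq_sym; congr (_ || _).
by rewrite [LHS]eq_sym (can2_eq (@gluedK S) (@gluedK S)).
Qed.

Lemma side_rel_trans (S : triangulated_surface) : transitive (@side_rel S).
Proof.
move=> s s1 s2; rewrite /side_rel => /orP[] /eqP-> /orP[] /eqP->;
  by rewrite ?gluedK eqxx ?orbT.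
Qed.

Canonical side_equiv (S : triangulated_surface) :=
  EquivRel (@side_rel S) (@side_rel_refl S) (@side_rel_sym S)
    (@side_rel_trans S).

Definition edge (S : triangulated_surface) := {eq_quot side_equiv S}%qT.
Definition edge_of (S : triangulated_surface) (s : side S) : edge S :=
  \pi_(edge S)%qT s.

Definition corner_step (S : triangulated_surface) : rel (corner S) :=
  fun x y => [exists a : 'I_3, (a != x.2) &&
    (y == (adj (x.1, a), gperm (x.1, a) x.2))].

Lemma corner_step_sym (S : triangulated_surface) : symmetric (@corner_step S).
Proof.
suff H : forall x y : corner S, corner_step x y -> corner_step y x.
  by move=> x y; apply/idP/idP; exact: H.
move=> [t b] y /existsP[a /andP[/= ab /eqP->]]; apply/existsP.
exists (gperm (t, a) a); rewrite /= (inj_eq perm_inj) ab /=.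
by rewrite (@adjK S (t, a)) (@gpermV S (t, a)) /= permK.
Qed.

Definition corner_rel (S : triangulated_surface) : rel (corner S) :=
  connect (@corner_step S).

Lemma corner_rel_sym (S : triangulated_surface) : symmetric (@corner_rel S).
Proof. exact/sym_connect_sym/corner_step_sym. Qed.

Canonical corner_equiv (S : triangulated_surface) :=
  EquivRel (@corner_rel S) (@connect0 _ _) (@corner_rel_sym S)
    (@connect_trans _ _).

Definition vertex (S : triangulated_surface) := {eq_quot corner_equiv S}%qT.
Definition vertex_of (S : triangulated_surface) (x : corner S) : vertex S :=
  \pi_(vertex S)%qT x.

Definition connected_surface (S : triangulated_surface) : Prop :=
  (0 < #|face S|)%N /\
  forall t t' : face S,
    connect (fun u u' => [exists a : 'I_3, u' == adj (u, a)]) t t'.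

Definition cosh {R : realType} (x : R) : R := (expR x + expR (- x)) / 2.

Definition arcosh {R : realType} (x : R) : R :=
  ln (x + Num.sqrt (x ^+ 2 - 1)).

Lemma arcosh_ge0 (R : realType) (x : R) : 1 <= x -> 0 <= arcosh x.
Proof. by move=> x1; apply: ln_ge0; rewrite -[1]addr0 lerD// sqrtr_ge0. Qed.

Lemma arcoshK (R : realType) (x : R) : 1 <= x -> cosh (arcosh x) = x.
Proof.
move=> x1; rewrite /cosh /arcosh expRN.
set q := Num.sqrt _.
have q0 : 0 <= q by exact: sqrtr_ge0.
have q2 : q ^+ 2 = x ^+ 2 - 1 by rewrite sqr_sqrtr//; nra.
have p0 : 0 < x + q by lra.
rewrite lnK ?posrE//.
suff -> : (x + q)^-1 = x - q by field.
by apply: (mulfI (lt0r_neq0 p0)); rewrite divff ?lt0r_neq0//; ring: q2.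
Qed.

Definition dot {R : realType} (u v : 'rV[R]_2) : R :=
  u 0 0 * v 0 0 + u 0 1 * v 0 1.

Definition euc_norm {R : realType} (u : 'rV[R]_2) : R := Num.sqrt (dot u u).

Definition euc_dist {R : realType} (p q : 'rV[R]_2) : R := euc_norm (q - p).

Definition euc_angle {R : realType} (p q r : 'rV[R]_2) : R :=
  acos (dot (q - p) (r - p) / (euc_norm (q - p) * euc_norm (r - p))).

(** The hyperbolic plane is the upper sheet of the hyperboloid
    <x, x> = -1 in Minkowski space. *)
Definition mink {R : realType} (u v : 'rV[R]_3) : R :=
  u 0 1 * v 0 1 + u 0 2 * v 0 2 - u 0 0 * v 0 0.

Definition hyp_plane {R : realType} (p : 'rV[R]_3) : Prop :=
  mink p p = -1 /\ 0 < p 0 0.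

Definition hyp_dist {R : realType} (p q : 'rV[R]_3) : R := arcosh (- mink p q).

(** The orthogonal projection of q to the tangent space at p, which is the
    initial direction of the geodesic from p to q.  The form [mink] is positive
    definite on that space. *)
Definition hyp_dir {R : realType} (p q : 'rV[R]_3) : 'rV[R]_3 :=
  q + mink p q *: p.

Definition mink_norm {R : realType} (u : 'rV[R]_3) : R := Num.sqrt (mink u u).

Definition hyp_angle {R : realType} (p q r : 'rV[R]_3) : R :=
  acos (mink (hyp_dir p q) (hyp_dir p r) /
        (mink_norm (hyp_dir p q) * mink_norm (hyp_dir p r))).

Variant geometry := Euclidean | Hyperbolic.

(** The set contains exactly one angle if lpq, lpr, lqr are positive and satisfy
    the strict triangle inequalities. *)
Definition inner_angle {R : realType} (g : geometry) (lpq lpr lqr : R) : R :=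
  match g with
  | Euclidean => xget 0 [set th | exists p q r : 'rV[R]_2,
      [/\ euc_dist p q = lpq, euc_dist p r = lpr, euc_dist q r = lqr
        & th = euc_angle p q r]]
  | Hyperbolic => xget 0 [set th | exists p q r : 'rV[R]_3,
      [/\ hyp_plane p, hyp_plane q & hyp_plane r] /\
      [/\ hyp_dist p q = lpq, hyp_dist p r = lpr, hyp_dist q r = lqr
        & th = hyp_angle p q r]]
  end%classic.

Definition conf_length {R : realType} (g : geometry) (es et : bool)
    (eta fs ft : R) : R :=
  match g with
  | Euclidean =>
      Num.sqrt (es%:R * expR (2 * fs) + et%:R * expR (2 * ft)
                + 2 * eta * expR (fs + ft))
  | Hyperbolic =>
      arcosh (Num.sqrt ((1 + es%:R * expR (2 * fs))
                        * (1 + et%:R * expR (2 * ft)))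
              + eta * expR (fs + ft))
  end.

(** In the following definitions a + 1 and a + 2 are taken modulo 3: they are
    the endpoints of the side opposite to the corner a. *)
Definition side_length {R : realType} (S : triangulated_surface)
    (eps : vertex S -> bool) (eta : edge S -> R) (g : geometry)
    (f : vertex S -> R) (s : side S) : R :=
  let i := vertex_of (s.1, s.2 + 1) in
  let j := vertex_of (s.1, s.2 + 2) in
  conf_length g (eps i) (eps j) (eta (edge_of s)) (f i) (f j).

Definition nondegenerate_factor {R : realType} (S : triangulated_surface)
    (eps : vertex S -> bool) (eta : edge S -> R) (g : geometry)
    (f : vertex S -> R) : Prop :=
  let l := side_length eps eta g f in
  forall (t : face S) (a : 'I_3), l (t, a) < l (t, a + 1) + l (t, a + 2).

Definition corner_angle {R : realType} (S : triangulated_surface)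
    (eps : vertex S -> bool) (eta : edge S -> R) (g : geometry)
    (f : vertex S -> R) (x : corner S) : R :=
  let l := side_length eps eta g f in
  inner_angle g (l (x.1, x.2 + 2)) (l (x.1, x.2 + 1)) (l x).

(** The sum is over corners rather than triangles because a triangle may have
    several corners at the same vertex. *)
Definition curvature {R : realType} (S : triangulated_surface)
    (eps : vertex S -> bool) (eta : edge S -> R) (g : geometry)
    (f : vertex S -> R) (v : vertex S) : R :=
  2 * pi - \sum_(x : corner S | vertex_of x == v) corner_angle eps eta g f x.

(* Main.v *)
Require Import Defs.
From HB Require Import structures.
From mathcomp Require Import all_boot all_order all_algebra all_fingroup.
From mathcomp Require Import all_classical all_reals all_analysis.
From mathcomp Require Import ring lra.

Set Implicit Arguments.
Unset Strict Implicit.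
Unset Printing Implicit Defensive.

Import Order.TTheory GRing.Theory Num.Theory.
Local Open Scope ring_scope.

(** Let [r_i = exp f_i], [E_i = eps_i r_i ^ 2] and [e_ij = eta_ij r_i r_j].  If
    vectors [v_i] have Gram entries [eps_i] and [- eta_ij], the lengths of a
    triangle are those of the triangle with vertices [r_i v_i] (Euclidean case),
    or of the triangle with vertices [(sqrt (1 + E_i), r_i v_i)] on a hyperboloid
    (hyperbolic case).  In suitable coordinates [u_i] the derivative of the
    angles is symmetric, and its weight on a side is, up to a positive factor, a
    barycentric coordinate of the foot of the perpendicular from the apex.  The
    determinant of this matrix is a multiple of a polynomial in which the
    expressions [eps_q eta_st + eta_qs eta_qt] have nonnegative coefficients, and
    which is bounded below by AM-GM by a multiple of
    [\prod (eps_s eps_t + eta_st)].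

    Two factors are joined by a segment in the coordinates [u], with velocity [b].
    On a triangle, [g = \sum_i b_i theta_i] has a negative derivative wherever the
    triangle is nondegenerate.  The angles extend continuously to the degenerate
    triangles by the values 0 and pi, so [g] takes finitely many values there, and
    this already implies that [g] decreases strictly.  Summing over the triangles,
    equal curvatures force [b] to be trivial on every triangle. *)

(** * Definiteness of the derivative of the angles *)

Section TriangleForms.
Variable R : realFieldType.

(** Sylvester's criterion: completing squares twice writes [a * m * Q] as a sum of squares with
    weights [m], 1 and [a * D], where [m] and [D] are the second and third leading minors. *)
Lemma posdef3 (a b c d e f x y z : R) :
  0 < a -> 0 < a * b - d ^+ 2 ->
  0 < a * b * c + 2 * d * e * f - a * f ^+ 2 - b * e ^+ 2 - c * d ^+ 2 ->
  (x, y, z) != (0, 0, 0) ->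
  0 < a * x ^+ 2 + b * y ^+ 2 + c * z ^+ 2
      + 2 * d * x * y + 2 * e * x * z + 2 * f * y * z.
Proof.
move=> a0; set m := a * b - _; set D := a * b * c + _ - _ - _ - _ => m0 D0 nz.
set Q := (X in 0 < X).
have Qe : a * m * Q = m * (a * x + d * y + e * z) ^+ 2
   + (m * y + (a * f - d * e) * z) ^+ 2 + a * D * z ^+ 2.
  by rewrite /Q /m /D; ring.
rewrite -(pmulr_rgt0 _ (mulr_gt0 a0 m0)) Qe.
have h1 : 0 <= m * (a * x + d * y + e * z) ^+ 2.
  by rewrite mulr_ge0 ?sqr_ge0// ltW.
have h2 := sqr_ge0 (m * y + (a * f - d * e) * z).
have h3 : 0 <= a * D * z ^+ 2 by rewrite mulr_ge0 ?sqr_ge0// mulr_ge0// ltW.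
have [z0|z0] := eqVneq z 0; last first.
  have z2 : 0 < z ^+ 2 by rewrite exprn_even_gt0.
  by rewrite ltr_wpDl ?addr_ge0// (mulr_gt0 (mulr_gt0 a0 D0)).
have [y0|y0] := eqVneq y 0; last first.
  have my : m * y != 0 by rewrite mulf_neq0// lt0r_neq0.
  by rewrite ltr_wpDr// ltr_wpDl// z0 mulr0 addr0 exprn_even_gt0.
have x0 : x != 0 by apply: contraNneq nz => ->; rewrite y0 z0.
rewrite ltr_wpDr// ltr_wpDr// y0 z0 !mulr0 !addr0.
have ax : a * x != 0 by rewrite mulf_neq0// lt0r_neq0.
by apply: mulr_gt0 => //; rewrite exprn_even_gt0.
Qed.

(* Here [c1], [c2], [c3] are the hyperbolic cosines of the sides opposite to the
   three vertices, and [C_i = sqrt (1 + E_i)]. *)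
Definition jac_cubic (c1 c2 c3 C1 C2 C3 : R) :=
  2 * (c1 * c2 * c3 - 1) * C1 * C2 * C3
  - (c1 * c2 - c3) * C3 * (C1 ^+ 2 + C2 ^+ 2)
  - (c1 * c3 - c2) * C2 * (C1 ^+ 2 + C3 ^+ 2)
  - (c2 * c3 - c1) * C1 * (C2 ^+ 2 + C3 ^+ 2).

(* First entry of [adj (c_ij) *m C], where [c_ii = 1]. *)
Definition foot_coord (c1 c2 c3 C1 C2 C3 : R) :=
  (1 - c1 ^+ 2) * C1 + (c1 * c2 - c3) * C2 + (c1 * c3 - c2) * C3.

(** The determinant of the symmetric matrix with unit diagonal and off-diagonal entries [c1], [c2],
    [c3]. For hyperbolic cosines of three positive lengths it is positive exactly when the strict
    triangle inequalities hold. *)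
Definition cosh_gram_det (c1 c2 c3 : R) :=
  1 + 2 * c1 * c2 * c3 - c1 ^+ 2 - c2 ^+ 2 - c3 ^+ 2.

(** One term per side: [c * (x ^+ 2 + y ^+ 2) - 2 * x * y] is the hyperbolic counterpart of
    [(x - y) ^+ 2], and [w_i] is the weight of the side opposite to vertex i. *)
Definition jac_form (c1 c2 c3 w1 w2 w3 b1 b2 b3 : R) :=
  w1 * (c1 * (b2 ^+ 2 + b3 ^+ 2) - 2 * b2 * b3)
  + w2 * (c2 * (b1 ^+ 2 + b3 ^+ 2) - 2 * b1 * b3)
  + w3 * (c3 * (b1 ^+ 2 + b2 ^+ 2) - 2 * b1 * b2).

(* Determinant of the matrix of [jac_form]. *)
Definition jac_det (c1 c2 c3 w1 w2 w3 : R) :=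
  2 * (c1 * c2 * c3 - 1) * w1 * w2 * w3
  + w1 ^+ 2 * (c1 ^+ 2 - 1) * (c2 * w2 + c3 * w3)
  + w2 ^+ 2 * (c2 ^+ 2 - 1) * (c1 * w1 + c3 * w3)
  + w3 ^+ 2 * (c3 ^+ 2 - 1) * (c1 * w1 + c2 * w2).

(** The left-hand side is [jac_det] at [w_i = N_i / (c_i ^ 2 - 1)], multiplied by the product of the
    [c_i ^ 2 - 1]. *)
Lemma jac_det_foot (c1 c2 c3 C1 C2 C3 : R) :
  let N1 := foot_coord c1 c2 c3 C1 C2 C3 in
  let N2 := foot_coord c2 c1 c3 C2 C1 C3 in
  let N3 := foot_coord c3 c1 c2 C3 C1 C2 in
  2 * (c1 * c2 * c3 - 1) * N1 * N2 * N3
  + N1 ^+ 2 * (N2 * c2 * (c3 ^+ 2 - 1) + N3 * c3 * (c2 ^+ 2 - 1))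
  + N2 ^+ 2 * (N1 * c1 * (c3 ^+ 2 - 1) + N3 * c3 * (c1 ^+ 2 - 1))
  + N3 ^+ 2 * (N1 * c1 * (c2 ^+ 2 - 1) + N2 * c2 * (c1 ^+ 2 - 1))
  = cosh_gram_det c1 c2 c3 ^+ 2 * jac_cubic c1 c2 c3 C1 C2 C3.
Proof. by rewrite /foot_coord /cosh_gram_det /jac_cubic /=; ring. Qed.

Lemma jac_cubicE (C1 C2 C3 e12 e13 e23 : R) :
  let E1 := C1 ^+ 2 - 1 in let E2 := C2 ^+ 2 - 1 in let E3 := C3 ^+ 2 - 1 in
  jac_cubic (C2 * C3 + e23) (C1 * C3 + e13) (C1 * C2 + e12) C1 C2 C3 =
  2 * C1 * C2 * C3 * (E1 * E2 * E3 + e12 * e13 * e23)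
  + (E1 * e23 + e12 * e13) * C1 * (C2 ^+ 2 * E3 + C3 ^+ 2 * E2)
  + (E2 * e13 + e12 * e23) * C2 * (C1 ^+ 2 * E3 + C3 ^+ 2 * E1)
  + (E3 * e12 + e13 * e23) * C3 * (C1 ^+ 2 * E2 + C2 ^+ 2 * E1).
Proof. by rewrite /jac_cubic /=; ring. Qed.

Lemma foot_coordE (C1 C2 C3 e12 e13 e23 : R) :
  let E1 := C1 ^+ 2 - 1 in let E2 := C2 ^+ 2 - 1 in let E3 := C3 ^+ 2 - 1 in
  foot_coord (C1 * C2 + e12) (C2 * C3 + e23) (C1 * C3 + e13) C3 C1 C2 =
  C3 * (E1 * E2 - e12 ^+ 2) + C1 * (E2 * e13 + e12 * e23) + C2 * (E1 * e23 + e12 * e13).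
Proof. by rewrite /foot_coord /=; ring. Qed.

Lemma foot_coord_adj (C1 C2 C3 e12 e13 e23 : R) :
  let E1 := C1 ^+ 2 - 1 in let E2 := C2 ^+ 2 - 1 in let E3 := C3 ^+ 2 - 1 in
  E1 * foot_coord (C1 * C2 + e12) (C2 * C3 + e23) (C1 * C3 + e13) C3 C1 C2 =
  (E1 * E2 - e12 ^+ 2) * (E1 * C3 + C1 * e13)
  + (E1 * e23 + e12 * e13) * (E1 * C2 + C1 * e12).
Proof. by rewrite /foot_coord /=; ring. Qed.

(** The foot coordinates are the adjugate applied to [C], so the matrix of the [c_i] sends them to
    [cosh_gram_det] times [C]. The identity is [c2] times the first row of this equation minus the
    third, which eliminates the first coordinate. *)
Lemma foot_coord_side (c1 c2 c3 C1 C2 C3 : R) :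
  (c2 ^+ 2 - 1) * foot_coord c3 c1 c2 C3 C1 C2 + (c2 * c3 - c1) * foot_coord c2 c1 c3 C2 C1 C3
  = cosh_gram_det c1 c2 c3 * (C1 * c2 - C3).
Proof. by rewrite /foot_coord /cosh_gram_det; ring. Qed.

Lemma foot_coordC (c1 c2 c3 C1 C2 C3 : R) :
  foot_coord c1 c3 c2 C1 C3 C2 = foot_coord c1 c2 c3 C1 C2 C3.
Proof. by rewrite /foot_coord; ring. Qed.

(** Instead of the second leading minor, the value at [(1, 1)] of the Schur complement of [a] is
    assumed positive. This complement has positive determinant, hence is definite, and a single
    value fixes its sign. *)
Lemma posdef3_schur (a b c d e f x y z : R) :
  0 < a -> (d + e) ^+ 2 < a * (b + c + 2 * f) ->
  0 < a * b * c + 2 * d * e * f - a * f ^+ 2 - b * e ^+ 2 - c * d ^+ 2 ->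
  (x, y, z) != (0, 0, 0) ->
  0 < a * x ^+ 2 + b * y ^+ 2 + c * z ^+ 2
      + 2 * d * x * y + 2 * e * x * z + 2 * f * y * z.
Proof.
move=> a0 s0 D0; apply: posdef3 => //.
have := mulr_gt0 a0 D0; set B := a * b - d ^+ 2.
have -> : a * (a * b * c + 2 * d * e * f - a * f ^+ 2 - b * e ^+ 2 - c * d ^+ 2)
  = B * (a * c - e ^+ 2) - (a * f - d * e) ^+ 2 by rewrite /B; ring.
set c' := a * c - _; set f' := a * f - _ => BC.
have S : 0 < B + c' + 2 * f' by rewrite /B /c' /f'; lra.
rewrite ltNge; apply/negP => B0.
have f2 := sqr_ge0 f'.
have c'0 : c' <= 0 by nra.
have h : 0 <= 2 * f' by lra.
have : (- (B + c')) ^+ 2 < (2 * f') ^+ 2 by nra.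
have := sqr_ge0 (B - c').
nra.
Qed.

Lemma jac_detE (c1 c2 c3 C1 C2 C3 w1 w2 w3 : R) :
  c1 ^+ 2 - 1 != 0 -> c2 ^+ 2 - 1 != 0 -> c3 ^+ 2 - 1 != 0 ->
  w1 = foot_coord c1 c2 c3 C1 C2 C3 / (c1 ^+ 2 - 1) ->
  w2 = foot_coord c2 c1 c3 C2 C1 C3 / (c2 ^+ 2 - 1) ->
  w3 = foot_coord c3 c1 c2 C3 C1 C2 / (c3 ^+ 2 - 1) ->
  jac_det c1 c2 c3 w1 w2 w3 =
  cosh_gram_det c1 c2 c3 ^+ 2 * jac_cubic c1 c2 c3 C1 C2 C3
    / ((c1 ^+ 2 - 1) * (c2 ^+ 2 - 1) * (c3 ^+ 2 - 1)).
Proof.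
move=> n1 n2 n3 -> -> ->; rewrite -jac_det_foot /jac_det; set N1 := foot_coord c1 _ _ _ _ _.
by set N2 := foot_coord c2 _ _ _ _ _; set N3 := foot_coord c3 _ _ _ _ _; field; apply/and3P.
Qed.

Lemma sqrB1_gt0 (c : R) : 1 < c -> 0 < c ^+ 2 - 1.
Proof. by move=> c1; rewrite subr_gt0 exprn_egt1. Qed.

(** For nonnegative weights, [2 x y <= x ^ 2 + y ^ 2] bounds the form below by a diagonal one. Its
    coefficients are positive because [jac_det] vanishes as soon as two weights do. *)
Lemma jac_form_gt0_nneg (c1 c2 c3 w1 w2 w3 b1 b2 b3 : R) :
  1 < c1 -> 1 < c2 -> 1 < c3 -> 0 <= w1 -> 0 <= w2 -> 0 <= w3 ->
  0 < jac_det c1 c2 c3 w1 w2 w3 -> (b1, b2, b3) != (0, 0, 0) ->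
  0 < jac_form c1 c2 c3 w1 w2 w3 b1 b2 b3.
Proof.
move=> h1 h2 h3 w1p w2p w3p D0 nz.
have t (w c x y : R) : 1 < c -> 0 <= w ->
  w * (c - 1) * (x ^+ 2 + y ^+ 2) <= w * (c * (x ^+ 2 + y ^+ 2) - 2 * x * y).
  by move=> c1' w0; have := mulr_ge0 w0 (sqr_ge0 (x - y)); nra.
have h : w1 * (c1 - 1) * (b2 ^+ 2 + b3 ^+ 2) + w2 * (c2 - 1) * (b1 ^+ 2 + b3 ^+ 2)
   + w3 * (c3 - 1) * (b1 ^+ 2 + b2 ^+ 2) <= jac_form c1 c2 c3 w1 w2 w3 b1 b2 b3.
  by rewrite /jac_form !lerD ?t.
apply: lt_le_trans h.
have -> : w1 * (c1 - 1) * (b2 ^+ 2 + b3 ^+ 2) + w2 * (c2 - 1) * (b1 ^+ 2 + b3 ^+ 2)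
   + w3 * (c3 - 1) * (b1 ^+ 2 + b2 ^+ 2) =
   (w2 * (c2 - 1) + w3 * (c3 - 1)) * b1 ^+ 2
   + (w1 * (c1 - 1) + w3 * (c3 - 1)) * b2 ^+ 2
   + (w1 * (c1 - 1) + w2 * (c2 - 1)) * b3 ^+ 2 by ring.
have q (w w' c c' : R) : 0 <= w -> 0 <= w' -> 1 < c -> 1 < c' ->
   (w, w') != (0, 0) -> 0 < w * (c - 1) + w' * (c' - 1).
  move=> w0 w'0 c1' c1''; have := w0; rewrite le_eqVlt => /orP[/eqP<- nz'|wp _].
    have w'p : 0 < w'.
      by rewrite lt_neqAle w'0 andbT; apply: contraNneq nz' => <-.
    by rewrite mul0r add0r mulr_gt0// subr_gt0.
  by rewrite ltr_pwDl ?mulr_gt0 ?subr_gt0// mulr_ge0// subr_ge0 ltW.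
have k1 : (w2, w3) != (0, 0).
  by apply: contraTneq D0 => -[-> ->]; rewrite /jac_det -leNgt; nra.
have k2 : (w1, w3) != (0, 0).
  by apply: contraTneq D0 => -[-> ->]; rewrite /jac_det -leNgt; nra.
have k3 : (w1, w2) != (0, 0).
  by apply: contraTneq D0 => -[-> ->]; rewrite /jac_det -leNgt; nra.
have := posdef3 (q _ _ _ _ w2p w3p h2 h3 k1) (b := w1 * (c1 - 1) + w3 * (c3 - 1))
  (c := w1 * (c1 - 1) + w2 * (c2 - 1)) (d := 0) (e := 0) (f := 0) (x := b1) (y := b2) (z := b3).
rewrite !expr0n/= !mulr0 !mul0r !subr0 !addr0; apply => //.
  by rewrite mulr_gt0 ?q.
by rewrite !mulr_gt0 ?q.
Qed.

(** If [w <= 0], then [L < 0], and multiplying [s |v| < |L| |w|] by [t |w| < |L| |v|] contradicts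
    [L ^ 2 < s t]. *)
Lemma gt0_of_gt0_comb (s t L w v : R) : 0 < s -> 0 < t -> L ^+ 2 < s * t -> v < 0 ->
  0 < s * v + L * w -> 0 < t * w + L * v -> 0 < w /\ 0 < L.
Proof.
move=> s0 t0 L2 v0 e1 e2.
have w0 : 0 < w.
  rewrite ltNge; apply/negP => w0.
  have L0 : L < 0 by nra.
  have f1 : s * - v < - L * - w by nra.
  have f2 : t * - w < - L * - v by nra.
  have f3 : 0 <= s * - v by nra.
  have f4 : 0 <= t * - w by nra.
  have w0' : w < 0.
    by rewrite lt_neqAle w0 andbT; apply: contraTneq e1 => ->; nra.
  have vw : 0 < v * w by rewrite nmulr_rgt0.
  rewrite -subr_gt0 in L2; have := mulr_gt0 vw L2.
  by have := ltr_pM f3 f4 f1 f2; nra.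
by split=> //; nra.
Qed.

(** For positive [X] and [Y] the inequality reads [k / X + k / Y < 1], or [k ^ 2 < (X - k) (Y - k)]
    with both factors positive. *)
Lemma harmonic_mono (k X Y X0 Y0 : R) : 0 < k -> 0 < X0 -> 0 < Y0 ->
  X0 < X -> Y0 < Y -> k * (X0 + Y0) < X0 * Y0 -> k * (X + Y) < X * Y.
Proof.
move=> kp x0 y0 xx yy xy.
have xk : 0 < X0 - k by rewrite -(pmulr_rgt0 _ y0); nra.
have yk : 0 < Y0 - k by rewrite -(pmulr_rgt0 _ x0); nra.
have := ltr_pM (ltW xk) (ltW yk) (_ : X0 - k < X - k) (_ : Y0 - k < Y - k).
by rewrite !ltrD2r => /(_ xx yy); nra.
Qed.

(** With [A = c1 w1 + c2 w2], [X = A + (w1 + w2)], [Y = A - (w1 + w2)] and [k = - (c3 - 1) w3], the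
    claim is [k (X + Y) < X Y]. The last two hypotheses say that [w1 > m P] and [w2 > m Q], so by
    [harmonic_mono] it suffices to treat these bounds, where the claim becomes [core]. *)
Lemma jac_schur_gt0 (c1 c2 c3 w1 w2 w3 : R) : 1 < c1 -> 1 < c2 -> 1 < c3 ->
  0 < cosh_gram_det c1 c2 c3 -> w3 < 0 -> 0 < c2 * c3 - c1 -> 0 < c1 * c3 - c2 ->
  0 < (c3 ^+ 2 - 1) * w3 + (c2 * c3 - c1) * w2 ->
  0 < (c3 ^+ 2 - 1) * w3 + (c1 * c3 - c2) * w1 ->
  (w1 + w2) ^+ 2 <
  (c1 * w1 + c2 * w2) * (c1 * w1 + c2 * w2 + 2 * (c3 - 1) * w3).
Proof.
move=> h1 h2 h3 D0 w3n.
set P := c2 * c3 - c1; set Q := c1 * c3 - c2 => P0 Q0 a13 a23.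
have c3p : 0 < c3 - 1 by rewrite subr_gt0.
pose k := - ((c3 - 1) * w3).
have kp : 0 < k by rewrite /k; nra.
(* After multiplication by [c3 - 1], the difference of the two sides is [(P + Q) ^ 2] times the Gram
   determinant. *)
have core : 2 * P * Q * (c1 * P + c2 * Q) <
    (c3 + 1) * ((c1 * P + c2 * Q) ^+ 2 - (P + Q) ^+ 2).
  rewrite -subr_gt0 -(pmulr_rgt0 _ c3p).
  rewrite (_ : (c3 - 1) * _ = (P + Q) ^+ 2 * cosh_gram_det c1 c2 c3).
    by apply: mulr_gt0 => //; apply: exprn_gt0; apply: addr_gt0.
  by rewrite /P /Q /cosh_gram_det; ring.
pose m := (c3 + 1) * k / (P * Q).
have c3q : 0 < c3 + 1 by lra.
have PQ : 0 < P * Q by rewrite mulr_gt0.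
have mp : 0 < m by rewrite divr_gt0 ?mulr_gt0.
have km : (c3 + 1) * k = m * (P * Q) by rewrite /m divfK// lt0r_neq0.
have w2m : m * Q < w2.
  rewrite -(ltr_pM2l P0) mulrCA -km.
  by move: a13; rewrite /k (_ : c3 ^+ 2 - 1 = (c3 - 1) * (c3 + 1)); [nra|ring].
have w1m : m * P < w1.
  rewrite -(ltr_pM2l Q0) mulrCA (mulrC Q) -km.
  by move: a23; rewrite /k (_ : c3 ^+ 2 - 1 = (c3 - 1) * (c3 + 1)); [nra|ring].
have mPp : 0 < m * P by rewrite mulr_gt0.
have mQp : 0 < m * Q by rewrite mulr_gt0.
have : k * ((c1 + 1) * w1 + (c2 + 1) * w2 + ((c1 - 1) * w1 + (c2 - 1) * w2)) <
    ((c1 + 1) * w1 + (c2 + 1) * w2) * ((c1 - 1) * w1 + (c2 - 1) * w2).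
  have c1m : 0 < c1 - 1 by rewrite subr_gt0.
  have c2m : 0 < c2 - 1 by rewrite subr_gt0.
  have c1p : 0 < c1 + 1 by lra.
  have c2p : 0 < c2 + 1 by lra.
  apply: (harmonic_mono kp (X0 := (c1 + 1) * (m * P) + (c2 + 1) * (m * Q))
    (Y0 := (c1 - 1) * (m * P) + (c2 - 1) * (m * Q))).
  - by apply: addr_gt0; apply: mulr_gt0.
  - by apply: addr_gt0; apply: mulr_gt0.
  - by apply: ltrD; rewrite ltr_pM2l.
  - by apply: ltrD; rewrite ltr_pM2l.
  rewrite -(ltr_pM2l c3q) [X in X < _]mulrA km.
  rewrite -subr_gt0 (_ : _ - _ = m ^+ 2 * ((c3 + 1) * ((c1 * P + c2 * Q) ^+ 2 - (P + Q) ^+ 2) - 2 * P * Q * (c1 * P + c2 * Q))); last by ring.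
  by apply: mulr_gt0; [exact: exprn_gt0|rewrite subr_gt0].
by rewrite /k; nra.
Qed.

(* The Schur complement of the third diagonal entry has a positive determinant, so
   that it suffices to find one vector at which it is positive: [(1, 1)]. *)
Lemma jac_form_gt0_neg (c1 c2 c3 w1 w2 w3 b1 b2 b3 : R) :
  1 < c1 -> 1 < c2 -> 1 < c3 -> 0 < cosh_gram_det c1 c2 c3 -> w3 < 0 ->
  0 < (c3 ^+ 2 - 1) * w3 + (c2 * c3 - c1) * w2 ->
  0 < (c2 ^+ 2 - 1) * w2 + (c2 * c3 - c1) * w3 ->
  0 < (c3 ^+ 2 - 1) * w3 + (c1 * c3 - c2) * w1 ->
  0 < (c1 ^+ 2 - 1) * w1 + (c1 * c3 - c2) * w3 ->
  0 < jac_det c1 c2 c3 w1 w2 w3 -> (b1, b2, b3) != (0, 0, 0) ->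
  0 < jac_form c1 c2 c3 w1 w2 w3 b1 b2 b3.
Proof.
move=> h1 h2 h3 D0 w3n a13 a12 a23 a21 W0 nz.
have s1 := sqrB1_gt0 h1; have s2 := sqrB1_gt0 h2; have s3 := sqrB1_gt0 h3.
have [|w2p P0] := gt0_of_gt0_comb s3 s2 _ w3n a13 a12.
  by move: D0; rewrite /cosh_gram_det; nra.
have [|w1p Q0] := gt0_of_gt0_comb s3 s1 _ w3n a23 a21.
  by move: D0; rewrite /cosh_gram_det; nra.
have Ap : 0 < c1 * w1 + c2 * w2 by rewrite addr_gt0 ?mulr_gt0// (lt_trans ltr01).
have Sp := jac_schur_gt0 h1 h2 h3 D0 w3n P0 Q0 a13 a23.
have := posdef3_schur (a := c1 * w1 + c2 * w2) (b := c3 * w3 + c2 * w2)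
  (c := c3 * w3 + c1 * w1) (d := - w2) (e := - w1) (f := - w3)
  (x := b3) (y := b1) (z := b2) Ap.
have -> : (- w2 - w1) ^+ 2 = (w1 + w2) ^+ 2 by ring.
have -> : c3 * w3 + c2 * w2 + (c3 * w3 + c1 * w1) + 2 * - w3 =
  c1 * w1 + c2 * w2 + 2 * (c3 - 1) * w3 by ring.
move=> /(_ Sp) H; rewrite (_ : jac_form _ _ _ _ _ _ _ _ _ =
  (c1 * w1 + c2 * w2) * b3 ^+ 2 + (c3 * w3 + c2 * w2) * b1 ^+ 2
  + (c3 * w3 + c1 * w1) * b2 ^+ 2 + 2 * - w2 * b3 * b1 + 2 * - w1 * b3 * b2
  + 2 * - w3 * b1 * b2); last by rewrite /jac_form; ring.
apply: H.
  by move: W0; rewrite (_ : jac_det _ _ _ _ _ _ = (c1 * w1 + c2 * w2) *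
    (c3 * w3 + c2 * w2) * (c3 * w3 + c1 * w1) + 2 * - w2 * - w1 * - w3
    - (c1 * w1 + c2 * w2) * (- w3) ^+ 2 - (c3 * w3 + c2 * w2) * (- w1) ^+ 2
    - (c3 * w3 + c1 * w1) * (- w2) ^+ 2)//; rewrite /jac_det; ring.
by apply: contraNneq nz => -[-> -> ->].
Qed.

Lemma jac_form_rot (c1 c2 c3 w1 w2 w3 b1 b2 b3 : R) :
  jac_form c2 c3 c1 w2 w3 w1 b2 b3 b1 = jac_form c1 c2 c3 w1 w2 w3 b1 b2 b3.
Proof. by rewrite /jac_form; ring. Qed.

Lemma cosh_gram_det_rot (c1 c2 c3 : R) : cosh_gram_det c2 c3 c1 = cosh_gram_det c1 c2 c3.
Proof. by rewrite /cosh_gram_det; ring. Qed.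

(** * Consequences of the conditions on the weights in the hyperbolic case *)

Lemma weight_AGM (e e' : bool) (x y u v : R) : 0 < x -> 0 < y -> 0 < u -> 0 < v ->
  2 * (e%:R * e'%:R) * (x * y) * (u * v) <=
  u ^+ 2 * (e'%:R * y ^+ 2) + v ^+ 2 * (e%:R * x ^+ 2).
Proof.
move=> x0 y0 u0 v0; have := sqr_ge0 (u * y - v * x).
have := sqr_ge0 (u * y); have := sqr_ge0 (v * x).
by case: e; case: e' => /=; nra.
Qed.

(** This relies on [e ^ 2 = e] for weights in {0, 1}; it assembles the AM-GM bounds into the product
    of the three edge conditions. *)
Lemma edge_weight_prod (e1 e2 e3 : bool) (h1 h2 h3 : R) :
  e1%:R * e2%:R * e3%:R + h1 * h2 * h3
  + (e1%:R * h1 + h2 * h3) * (e2%:R * e3%:R)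
  + (e2%:R * h2 + h1 * h3) * (e1%:R * e3%:R)
  + (e3%:R * h3 + h1 * h2) * (e1%:R * e2%:R) =
  (e2%:R * e3%:R + h1) * (e1%:R * e3%:R + h2) * (e1%:R * e2%:R + h3).
Proof. by case: e1; case: e2; case: e3 => /=; ring. Qed.

(** In [jac_cubicE] each [C_j ^ 2 E_k + C_k ^ 2 E_j] is bounded below by [weight_AGM]. Its
    coefficient is nonnegative by the condition on the face, and the bounds add up to a multiple of
    [edge_weight_prod]. *)
Lemma jac_cubic_gt0 (e1 e2 e3 : bool) (r1 r2 r3 C1 C2 C3 h1 h2 h3 : R) :
  0 < r1 -> 0 < r2 -> 0 < r3 -> 0 < C1 -> 0 < C2 -> 0 < C3 ->
  C1 ^+ 2 = 1 + e1%:R * r1 ^+ 2 -> C2 ^+ 2 = 1 + e2%:R * r2 ^+ 2 ->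
  C3 ^+ 2 = 1 + e3%:R * r3 ^+ 2 ->
  0 < e2%:R * e3%:R + h1 -> 0 < e1%:R * e3%:R + h2 -> 0 < e1%:R * e2%:R + h3 ->
  0 <= e1%:R * h1 + h2 * h3 -> 0 <= e2%:R * h2 + h1 * h3 ->
  0 <= e3%:R * h3 + h1 * h2 ->
  0 < jac_cubic (C2 * C3 + h1 * (r2 * r3)) (C1 * C3 + h2 * (r1 * r3))
           (C1 * C2 + h3 * (r1 * r2)) C1 C2 C3.
Proof.
move=> r1p r2p r3p C1p C2p C3p q1 q2 q3 d1 d2 d3 g1 g2 g3; rewrite jac_cubicE /=.
have -> : C1 ^+ 2 - 1 = e1%:R * r1 ^+ 2 by rewrite q1; ring.
have -> : C2 ^+ 2 - 1 = e2%:R * r2 ^+ 2 by rewrite q2; ring.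
have -> : C3 ^+ 2 - 1 = e3%:R * r3 ^+ 2 by rewrite q3; ring.
have r1n := ltW r1p; have r2n := ltW r2p; have r3n := ltW r3p.
have C1n := ltW C1p; have C2n := ltW C2p; have C3n := ltW C3p.
have b1 := weight_AGM e2 e3 r2p r3p C2p C3p.
have b2 := weight_AGM e1 e3 r1p r3p C1p C3p.
have b3 := weight_AGM e1 e2 r1p r2p C1p C2p.
have m1 := ler_wpM2l (mulr_ge0 g1 (mulr_ge0 (mulr_ge0 (sqr_ge0 r1) (mulr_ge0 r2n r3n)) C1n)) b1.
have m2 := ler_wpM2l (mulr_ge0 g2 (mulr_ge0 (mulr_ge0 (sqr_ge0 r2) (mulr_ge0 r1n r3n)) C2n)) b2.
have m3 := ler_wpM2l (mulr_ge0 g3 (mulr_ge0 (mulr_ge0 (sqr_ge0 r3) (mulr_ge0 r1n r2n)) C3n)) b3.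
apply: lt_le_trans (_ : 0 < 2 * C1 * C2 * C3 * (r1 * r2 * r3) ^+ 2 *
  ((e2%:R * e3%:R + h1) * (e1%:R * e3%:R + h2) * (e1%:R * e2%:R + h3))) _.
  by rewrite !mulr_gt0 ?exprn_gt0 ?mulr_gt0.
rewrite -edge_weight_prod.
have := lerD (lerD m1 m2) m3.
rewrite -(lerD2l (2 * C1 * C2 * C3 * (r1 * r2 * r3) ^+ 2 * (e1%:R * e2%:R * e3%:R + h1 * h2 * h3))).
congr (is_true (_ <= _)); ring.
Qed.

(** Cauchy-Schwarz gives [C1 C2 >= 1 + e1 e2 r1 r2]; the edge condition does the rest. *)
Lemma edge_cosh_gt1 (e1 e2 : bool) (r1 r2 C1 C2 h : R) :
  0 < r1 -> 0 < r2 -> 0 < C1 -> 0 < C2 ->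
  C1 ^+ 2 = 1 + e1%:R * r1 ^+ 2 -> C2 ^+ 2 = 1 + e2%:R * r2 ^+ 2 ->
  0 < e1%:R * e2%:R + h -> 1 < C1 * C2 + h * (r1 * r2).
Proof.
move=> r1p r2p C1p C2p q1 q2 d.
have rr : 0 < r1 * r2 by rewrite mulr_gt0.
have CC : 0 < C1 * C2 by rewrite mulr_gt0.
have q : (1 + e1%:R * e2%:R * (r1 * r2)) ^+ 2 <= (C1 * C2) ^+ 2.
  rewrite exprMn q1 q2; case: e1 {q1 d}; case: e2 {q2} => /=; last by lra.
  - by have := sqr_ge0 (r1 - r2); lra.
  - by have := sqr_ge0 r1; lra.
  - by have := sqr_ge0 r2; lra.
have n0 : 0 <= e1%:R * e2%:R :> R by rewrite mulr_ge0.
have {q} : 1 + e1%:R * e2%:R * (r1 * r2) <= C1 * C2.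
  rewrite ler_pXn2r// in q; rewrite nnegrE ?ltW//; nra.
by have := mulr_gt0 d rr; lra.
Qed.

(* If [E1 > 0], the coefficients in [foot_coord_adj] have opposite signs. *)
Lemma foot_coord_lt0 (e1 e2 e3 : bool) (r1 r2 r3 C1 C2 C3 h1 h2 h3 : R) :
  0 < r1 -> 0 < r2 -> 0 < r3 -> 0 < C1 -> 0 < C2 -> 0 < C3 ->
  C1 ^+ 2 = 1 + e1%:R * r1 ^+ 2 -> C2 ^+ 2 = 1 + e2%:R * r2 ^+ 2 ->
  C3 ^+ 2 = 1 + e3%:R * r3 ^+ 2 ->
  0 < e2%:R * e3%:R + h1 -> 0 < e1%:R * e3%:R + h2 -> 0 < e1%:R * e2%:R + h3 ->
  0 <= e1%:R * h1 + h2 * h3 -> 0 <= e2%:R * h2 + h1 * h3 ->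
  foot_coord (C1 * C2 + h3 * (r1 * r2)) (C2 * C3 + h1 * (r2 * r3))
       (C1 * C3 + h2 * (r1 * r3)) C3 C1 C2 < 0 ->
  0 < C1 * (C1 * C2 + h3 * (r1 * r2)) - C2 /\ 0 < C1 * (C1 * C3 + h2 * (r1 * r3)) - C3.
Proof.
move=> r1p r2p r3p C1p C2p C3p q1 q2 q3 d1 d2 d3 g1 g2 N3.
have E1 : C1 ^+ 2 - 1 = e1%:R * r1 ^+ 2 by rewrite q1; ring.
have E2 : C2 ^+ 2 - 1 = e2%:R * r2 ^+ 2 by rewrite q2; ring.
have rr : 0 < r1 * r2 by rewrite mulr_gt0.
have rrr : 0 < r1 * r2 * r3 by rewrite mulr_gt0.
have G1 : 0 <= (C1 ^+ 2 - 1) * (h1 * (r2 * r3)) + h3 * (r1 * r2) * (h2 * (r1 * r3)).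
  rewrite E1 (_ : _ + _ = (e1%:R * h1 + h2 * h3) * r1 * (r1 * r2 * r3)); last by ring.
  by rewrite !mulr_ge0// ltW.
have G2 : 0 <= (C2 ^+ 2 - 1) * (h2 * (r1 * r3)) + h3 * (r1 * r2) * (h1 * (r2 * r3)).
  rewrite E2 (_ : _ + _ = (e2%:R * h2 + h1 * h3) * r2 * (r1 * r2 * r3)); last by ring.
  by rewrite !mulr_ge0// ltW.
have DE : (C1 ^+ 2 - 1) * (C2 ^+ 2 - 1) - (h3 * (r1 * r2)) ^+ 2 =
    (e1%:R * e2%:R - h3 ^+ 2) * (r1 * r2) ^+ 2 by rewrite E1 E2; ring.
(* Otherwise all three terms of [foot_coordE] are nonnegative. *)
have h3x : e1%:R * e2%:R < h3 ^+ 2.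
  rewrite ltNge; apply/negP => h; move: N3; rewrite foot_coordE ltNge => /negP; apply.
  have := G1; have := G2; rewrite DE => G2' G1'.
  apply: addr_ge0; first apply: addr_ge0; apply: mulr_ge0 => //; try exact: ltW.
  by rewrite mulr_ge0 ?sqr_ge0 ?subr_ge0.
have h3p : 0 < h3.
  by move: d3 h3x; case: (e1); case: (e2) => /=;
    rewrite ?mulr0 ?mul0r ?mulr1 ?add0r//; nra.
have a12 : 0 < C1 * (C1 * C2 + h3 * (r1 * r2)) - C2.
  rewrite (_ : _ - _ = (C1 ^+ 2 - 1) * C2 + C1 * (h3 * (r1 * r2))); last by ring.
  rewrite E1; apply: ltr_wpDl; last by rewrite !mulr_gt0.
  by apply: mulr_ge0; [apply: mulr_ge0; rewrite ?sqr_ge0|exact: ltW].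
split; first exact: a12.
move: E1; have := d2; have [e1t _ E1|e1f] := boolP e1; last first.
  rewrite !mul0r add0r => h2p E1.
  rewrite (_ : _ - _ = (C1 ^+ 2 - 1) * C3 + C1 * (h2 * (r1 * r3))); last by ring.
  by rewrite E1 mul0r add0r !mulr_gt0.
have E1p : 0 < C1 ^+ 2 - 1 by rewrite E1 mul1r exprn_gt0.
have := foot_coord_adj C1 C2 C3 (h3 * (r1 * r2)) (h2 * (r1 * r3)) (h1 * (r2 * r3)).
set N := foot_coord _ _ _ _ _ _ in N3 *; move=> /= id2.
have : (C1 ^+ 2 - 1) * N < 0 by rewrite pmulr_rlt0.
rewrite id2 => lt0.
rewrite (_ : _ - _ = (C1 ^+ 2 - 1) * C3 + C1 * (h2 * (r1 * r3))); last by ring.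
rewrite -(nmulr_rlt0 _ (_ : (C1 ^+ 2 - 1) * (C2 ^+ 2 - 1) - (h3 * (r1 * r2)) ^+ 2 < 0)).
  apply: le_lt_trans lt0; rewrite lerDl mulr_ge0//.
  move: a12; rewrite (_ : _ - _ = (C1 ^+ 2 - 1) * C2 + C1 * (h3 * (r1 * r2))); last by ring.
  exact: ltW.
by rewrite DE pmulr_llt0 ?exprn_gt0// subr_lt0.
Qed.

Definition hyp_form (c1 c2 c3 C1 C2 C3 b1 b2 b3 : R) :=
  jac_form c1 c2 c3 (foot_coord c1 c2 c3 C1 C2 C3 / (c1 ^+ 2 - 1))
    (foot_coord c2 c1 c3 C2 C1 C3 / (c2 ^+ 2 - 1))
    (foot_coord c3 c1 c2 C3 C1 C2 / (c3 ^+ 2 - 1)) b1 b2 b3.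

Lemma hyp_form_rot (c1 c2 c3 C1 C2 C3 b1 b2 b3 : R) :
  hyp_form c2 c3 c1 C2 C3 C1 b2 b3 b1 = hyp_form c1 c2 c3 C1 C2 C3 b1 b2 b3.
Proof.
by rewrite /hyp_form jac_form_rot (foot_coordC c2 c1) (foot_coordC c3 c1).
Qed.

(** [foot_coord_lt0], applied also with vertices 1 and 2 exchanged, gives four positive quantities
    [C_i c - C_j]; by [foot_coord_side] these are the four mixed hypotheses of
    [jac_form_gt0_neg]. *)
Lemma hyp_form_gt0_neg (e1 e2 e3 : bool) (r1 r2 r3 C1 C2 C3 h1 h2 h3 b1 b2 b3 : R) :
  0 < r1 -> 0 < r2 -> 0 < r3 -> 0 < C1 -> 0 < C2 -> 0 < C3 ->
  C1 ^+ 2 = 1 + e1%:R * r1 ^+ 2 -> C2 ^+ 2 = 1 + e2%:R * r2 ^+ 2 ->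
  C3 ^+ 2 = 1 + e3%:R * r3 ^+ 2 ->
  0 < e2%:R * e3%:R + h1 -> 0 < e1%:R * e3%:R + h2 -> 0 < e1%:R * e2%:R + h3 ->
  0 <= e1%:R * h1 + h2 * h3 -> 0 <= e2%:R * h2 + h1 * h3 ->
  0 <= e3%:R * h3 + h1 * h2 ->
  let c1 := C2 * C3 + h1 * (r2 * r3) in
  let c2 := C1 * C3 + h2 * (r1 * r3) in
  let c3 := C1 * C2 + h3 * (r1 * r2) in
  0 < cosh_gram_det c1 c2 c3 -> foot_coord c3 c1 c2 C3 C1 C2 < 0 -> (b1, b2, b3) != (0, 0, 0) ->
  0 < hyp_form c1 c2 c3 C1 C2 C3 b1 b2 b3.
Proof.
move=> r1p r2p r3p C1p C2p C3p q1 q2 q3 d1 d2 d3 g1 g2 g3 c1 c2 c3 D0 N3 nz.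
have Z0 := jac_cubic_gt0 r1p r2p r3p C1p C2p C3p q1 q2 q3 d1 d2 d3 g1 g2 g3.
have h1c : 1 < c1 := edge_cosh_gt1 r2p r3p C2p C3p q2 q3 d1.
have h2c : 1 < c2 := edge_cosh_gt1 r1p r3p C1p C3p q1 q3 d2.
have h3c : 1 < c3 := edge_cosh_gt1 r1p r2p C1p C2p q1 q2 d3.
have [a12 a13] := foot_coord_lt0 r1p r2p r3p C1p C2p C3p q1 q2 q3 d1 d2 d3 g1 g2 N3.
have d3s : 0 < e2%:R * e1%:R + h3 by rewrite mulrC.
have N3s : foot_coord (C2 * C1 + h3 * (r2 * r1)) c2 c1 C3 C2 C1 < 0.
  by rewrite (mulrC C2) (mulrC r2) foot_coordC.
have [] := foot_coord_lt0 r2p r1p r3p C2p C1p C3p q2 q1 q3 d2 d1 d3s g2 g1 N3s.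
rewrite (mulrC C2 C1) (mulrC r2 r1) -/c1 -/c3 => a21 a23.
rewrite -/c1 -/c2 -/c3 in a12 a13 Z0.
clearbody c1 c2 c3; clear -D0 N3 nz Z0 h1c h2c h3c a12 a13 a21 a23.
have s1 := sqrB1_gt0 h1c; have s2 := sqrB1_gt0 h2c; have s3 := sqrB1_gt0 h3c.
have n1 := lt0r_neq0 s1; have n2 := lt0r_neq0 s2; have n3 := lt0r_neq0 s3.
rewrite /hyp_form.
have Dr : cosh_gram_det c1 c3 c2 = cosh_gram_det c1 c2 c3 by rewrite /cosh_gram_det; ring.
have Dr2 : cosh_gram_det c2 c1 c3 = cosh_gram_det c1 c2 c3 by rewrite /cosh_gram_det; ring.
have := jac_detE n1 n2 n3 erefl erefl erefl (C1 := C1) (C2 := C2) (C3 := C3).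
have := foot_coord_side c1 c2 c3 C1 C2 C3; have := foot_coord_side c2 c1 c3 C2 C1 C3.
have := foot_coord_side c1 c3 c2 C1 C3 C2; have := foot_coord_side c2 c3 c1 C2 C3 C1.
rewrite !(foot_coordC c3 c1 c2) Dr Dr2 cosh_gram_det_rot.
set N1 := foot_coord c1 c2 c3 C1 C2 C3; set N2 := foot_coord c2 c1 c3 C2 C1 C3.
set N3' := foot_coord c3 c1 c2 C3 C1 C2 in N3 *.
move=> i21 i12 i23 i13 dW; apply: jac_form_gt0_neg => //.
- by rewrite pmulr_llt0 ?invr_gt0.
- rewrite -(pmulr_rgt0 _ s2) (_ : (c2 ^+ 2 - 1) * _ = cosh_gram_det c1 c2 c3 * (C1 * c2 - C3)).
    by rewrite mulr_gt0.
  by rewrite -i13; field; rewrite ?n1 ?n2 ?n3.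
- rewrite -(pmulr_rgt0 _ s3) (_ : (c3 ^+ 2 - 1) * _ = cosh_gram_det c1 c2 c3 * (C1 * c3 - C2)).
    by rewrite mulr_gt0.
  by rewrite -i12; field; rewrite ?n1 ?n2 ?n3.
- rewrite -(pmulr_rgt0 _ s1) (_ : (c1 ^+ 2 - 1) * _ = cosh_gram_det c1 c2 c3 * (C2 * c1 - C3)).
    by rewrite mulr_gt0.
  by rewrite -i23; field; rewrite ?n1 ?n2 ?n3.
- rewrite -(pmulr_rgt0 _ s3) (_ : (c3 ^+ 2 - 1) * _ = cosh_gram_det c1 c2 c3 * (C2 * c3 - C1)).
    by rewrite mulr_gt0.
  by rewrite -i21; field; rewrite ?n1 ?n2 ?n3.
- by rewrite dW divr_gt0 ?mulr_gt0 ?exprn_gt0.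
Qed.

(** A negative foot coordinate is brought to the third place by a cyclic rotation of the vertices;
    if there is none, all weights are nonnegative. *)
Lemma hyp_form_gt0 (e1 e2 e3 : bool) (r1 r2 r3 C1 C2 C3 h1 h2 h3 b1 b2 b3 : R) :
  0 < r1 -> 0 < r2 -> 0 < r3 -> 0 < C1 -> 0 < C2 -> 0 < C3 ->
  C1 ^+ 2 = 1 + e1%:R * r1 ^+ 2 -> C2 ^+ 2 = 1 + e2%:R * r2 ^+ 2 ->
  C3 ^+ 2 = 1 + e3%:R * r3 ^+ 2 ->
  0 < e2%:R * e3%:R + h1 -> 0 < e3%:R * e1%:R + h2 -> 0 < e1%:R * e2%:R + h3 ->
  0 <= e1%:R * h1 + h2 * h3 -> 0 <= e2%:R * h2 + h3 * h1 ->
  0 <= e3%:R * h3 + h1 * h2 ->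
  let c1 := C2 * C3 + h1 * (r2 * r3) in
  let c2 := C3 * C1 + h2 * (r3 * r1) in
  let c3 := C1 * C2 + h3 * (r1 * r2) in
  0 < cosh_gram_det c1 c2 c3 -> (b1, b2, b3) != (0, 0, 0) ->
  0 < hyp_form c1 c2 c3 C1 C2 C3 b1 b2 b3.
Proof.
move=> r1p r2p r3p C1p C2p C3p q1 q2 q3 d1 d2 d3 g1 g2 g3.
rewrite (mulrC C3) (mulrC r3) (mulrC h3 h1) (mulrC e3%:R) in d2 g2 *.
move=> c1 c2 c3 D0 nz.
have [N3|N3] := ltP (foot_coord c3 c1 c2 C3 C1 C2) 0.
  exact: (hyp_form_gt0_neg r1p r2p r3p C1p C2p C3p q1 q2 q3 d1 d2 d3 g1 g2 g3).
have [N1|N1] := ltP (foot_coord c1 c2 c3 C1 C2 C3) 0.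
  rewrite -hyp_form_rot.
  have := @hyp_form_gt0_neg e2 e3 e1 r2 r3 r1 C2 C3 C1 h2 h3 h1 b2 b3 b1
    r2p r3p r1p C2p C3p C1p q2 q3 q1.
  rewrite ?[e3%:R * e1%:R]mulrC ?[e2%:R * e1%:R]mulrC ?[h3 * h1]mulrC ?[h2 * h1]mulrC
    ?[C3 * C1]mulrC ?[C2 * C1]mulrC ?[r3 * r1]mulrC ?[r2 * r1]mulrC ?[h3 * h2]mulrC => /(_ d2 d3 d1 g2 g3 g1).
  apply; first by rewrite cosh_gram_det_rot.
    exact: N1.
  by apply: contraNneq nz => -[-> -> ->].
have [N2|N2] := ltP (foot_coord c2 c1 c3 C2 C1 C3) 0.
  rewrite -hyp_form_rot -hyp_form_rot.
  have := @hyp_form_gt0_neg e3 e1 e2 r3 r1 r2 C3 C1 C2 h3 h1 h2 b3 b1 b2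
    r3p r1p r2p C3p C1p C2p q3 q1 q2.
  rewrite ?[e3%:R * e1%:R]mulrC ?[e3%:R * e2%:R]mulrC ?[h3 * h1]mulrC ?[h2 * h1]mulrC
    ?[C3 * C1]mulrC ?[C3 * C2]mulrC ?[r3 * r1]mulrC ?[r3 * r2]mulrC ?[h3 * h2]mulrC => /(_ d3 d1 d2 g3 g1 g2).
  apply; first by rewrite -cosh_gram_det_rot.
    by rewrite foot_coordC; exact: N2.
  by apply: contraNneq nz => -[-> -> ->].
have h1c : 1 < c1 := edge_cosh_gt1 r2p r3p C2p C3p q2 q3 d1.
have h2c : 1 < c2 := edge_cosh_gt1 r1p r3p C1p C3p q1 q3 d2.
have h3c : 1 < c3 := edge_cosh_gt1 r1p r2p C1p C2p q1 q2 d3.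
have Z0 := jac_cubic_gt0 r1p r2p r3p C1p C2p C3p q1 q2 q3 d1 d2 d3 g1 g2 g3.
rewrite -/c1 -/c2 -/c3 in Z0; clearbody c1 c2 c3.
have s1 := sqrB1_gt0 h1c; have s2 := sqrB1_gt0 h2c; have s3 := sqrB1_gt0 h3c.
rewrite /hyp_form; apply: jac_form_gt0_nneg => //; try by apply: divr_ge0 => //; exact: ltW.
have n1 := lt0r_neq0 s1; have n2 := lt0r_neq0 s2; have n3 := lt0r_neq0 s3.
have dW := jac_detE n1 n2 n3 erefl erefl erefl (C1 := C1) (C2 := C2) (C3 := C3).
by rewrite dW divr_gt0 ?mulr_gt0 ?exprn_gt0.
Qed.

(* [- sqrt Delta] times the derivative of [\sum_i b_i theta_i], where
   [cos theta_i = P_i / sqrt (S_j S_k)] and [Delta = S_j S_k - P_i ^ 2]. *)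
Definition angle_speed (b1 b2 b3 P1 P2 P3 S1 S2 S3 dP1 dP2 dP3 dS1 dS2 dS3 : R) :=
  b1 * (dP1 - P1 * (dS2 / (2 * S2) + dS3 / (2 * S3)))
  + b2 * (dP2 - P2 * (dS3 / (2 * S3) + dS1 / (2 * S1)))
  + b3 * (dP3 - P3 * (dS1 / (2 * S1) + dS2 / (2 * S2))).

(** Here [d1], [d2], [d3] are the derivatives of [c1], [c2], [c3] when the coordinates [u] move with
    velocity [b]. *)
Lemma hyp_angle_speed (c1 c2 c3 C1 C2 C3 b1 b2 b3 : R) :
  let d1 := (C2 * c1 - C3) * b2 + (C3 * c1 - C2) * b3 in
  let d2 := (C3 * c2 - C1) * b3 + (C1 * c2 - C3) * b1 in
  let d3 := (C1 * c3 - C2) * b1 + (C2 * c3 - C1) * b2 in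
  c1 ^+ 2 - 1 != 0 -> c2 ^+ 2 - 1 != 0 -> c3 ^+ 2 - 1 != 0 ->
  angle_speed b1 b2 b3 (c2 * c3 - c1) (c3 * c1 - c2) (c1 * c2 - c3)
    (c1 ^+ 2 - 1) (c2 ^+ 2 - 1) (c3 ^+ 2 - 1)
    (d2 * c3 + c2 * d3 - d1) (d3 * c1 + c3 * d1 - d2) (d1 * c2 + c1 * d2 - d3)
    (2 * c1 * d1) (2 * c2 * d2) (2 * c3 * d3) = hyp_form c1 c2 c3 C1 C2 C3 b1 b2 b3.
Proof.
move=> d1 d2 d3 n1 n2 n3; rewrite /angle_speed /hyp_form /jac_form /foot_coord /d1 /d2 /d3.
by field; rewrite n1 n2 n3.
Qed.

(** * The Euclidean form *)

Definition euc_foot_coord (x1 x2 x3 E1 E2 E3 : R) :=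
  E2 * E3 - x1 ^+ 2 + (E2 * x2 + x1 * x3) + (E3 * x3 + x1 * x2).

Definition euc_form (x1 x2 x3 E1 E2 E3 b1 b2 b3 : R) :=
  euc_foot_coord x1 x2 x3 E1 E2 E3 / (E2 + E3 + 2 * x1) * (b2 - b3) ^+ 2
  + euc_foot_coord x2 x3 x1 E2 E3 E1 / (E3 + E1 + 2 * x2) * (b3 - b1) ^+ 2
  + euc_foot_coord x3 x1 x2 E3 E1 E2 / (E1 + E2 + 2 * x3) * (b1 - b2) ^+ 2.

(** Here [d1], [d2], [d3] are the derivatives of the squared lengths when [f] moves with velocity
    [b]. *)
Lemma euc_angle_speed (x1 x2 x3 E1 E2 E3 b1 b2 b3 : R) :
  let L1 := E2 + E3 + 2 * x1 in
  let L2 := E3 + E1 + 2 * x2 in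
  let L3 := E1 + E2 + 2 * x3 in
  let d1 := 2 * (E2 + x1) * b2 + 2 * (E3 + x1) * b3 in
  let d2 := 2 * (E3 + x2) * b3 + 2 * (E1 + x2) * b1 in
  let d3 := 2 * (E1 + x3) * b1 + 2 * (E2 + x3) * b2 in
  L1 != 0 -> L2 != 0 -> L3 != 0 ->
  angle_speed b1 b2 b3 ((L2 + L3 - L1) / 2) ((L3 + L1 - L2) / 2)
   ((L1 + L2 - L3) / 2) L1 L2 L3 ((d2 + d3 - d1) / 2) ((d3 + d1 - d2) / 2)
   ((d1 + d2 - d3) / 2) d1 d2 d3 = euc_form x1 x2 x3 E1 E2 E3 b1 b2 b3.
Proof.
move=> L1 L2 L3 d1 d2 d3 n1 n2 n3.
rewrite /angle_speed /euc_form /euc_foot_coord /d1 /d2 /d3 -/L1 -/L2 -/L3.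
have e1 : x1 = (L1 - E2 - E3) / 2 by rewrite /L1; field.
have e2 : x2 = (L2 - E3 - E1) / 2 by rewrite /L2; field.
have e3 : x3 = (L3 - E1 - E2) / 2 by rewrite /L3; field.
move: n1 n2 n3 e1 e2 e3; move: L1 L2 L3 d1 d2 d3.
move=> L1 L2 L3 _ _ _ n1 n2 n3 -> -> ->.
by field; rewrite n1 n2 n3.
Qed.

(** For a triangle with squared lengths [L_i], the sum is four times the squared area. *)
Lemma euc_foot_coord_sum (x1 x2 x3 E1 E2 E3 : R) :
  let L1 := E2 + E3 + 2 * x1 in
  let L2 := E3 + E1 + 2 * x2 in
  let L3 := E1 + E2 + 2 * x3 in
  euc_foot_coord x1 x2 x3 E1 E2 E3 + euc_foot_coord x2 x3 x1 E2 E3 E1 + euc_foot_coord x3 x1 x2 E3 E1 E2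
  = L1 * L2 - ((L1 + L2 - L3) / 2) ^+ 2.
Proof. by rewrite /euc_foot_coord /=; field. Qed.

(** Divided by [L1 L2 L3], the left-hand side is the determinant of [euc_form] in two differences of
    the [b_i]. The last factor is [jac_cubicE] with each [C_i] outside the [E_i] replaced by 1. *)
Lemma euc_foot_coord_prod (x1 x2 x3 E1 E2 E3 : R) :
  let L1 := E2 + E3 + 2 * x1 in
  let L2 := E3 + E1 + 2 * x2 in
  let L3 := E1 + E2 + 2 * x3 in
  let N1 := euc_foot_coord x1 x2 x3 E1 E2 E3 in
  let N2 := euc_foot_coord x2 x3 x1 E2 E3 E1 in
  let N3 := euc_foot_coord x3 x1 x2 E3 E1 E2 in
  N2 * N3 * L1 + N1 * N3 * L2 + N1 * N2 * L3 =
  (N1 + N2 + N3) * (2 * E1 * E2 * E3 + 2 * x1 * x2 * x3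
   + (E1 * x1 + x2 * x3) * (E2 + E3) + (E2 * x2 + x3 * x1) * (E3 + E1)
   + (E3 * x3 + x1 * x2) * (E1 + E2)).
Proof. by rewrite /euc_foot_coord /=; ring. Qed.

Lemma edge_length_gt0 (e1 e2 : bool) (r1 r2 h : R) :
  0 < r1 -> 0 < r2 -> 0 < e1%:R * e2%:R + h ->
  0 < e1%:R * r1 ^+ 2 + e2%:R * r2 ^+ 2 + 2 * (h * (r1 * r2)).
Proof.
move=> r1p r2p d.
have := weight_AGM e2 e1 r2p r1p ltr01 ltr01.
have := mulr_gt0 d (mulr_gt0 r1p r2p).
by rewrite !expr1n; lra.
Qed.

(** The determinant of the form is [w2 w3 + w1 w3 + w1 w2], so the form is definite. Its trace
    against the positive definite matrix with diagonal [L1], [L2] and off-diagonal entry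
    [- (L1 + L2 - L3) / 2] is [w1 L1 + w2 L2 + w3 L3], which excludes the negative sign. *)
Lemma euc_posdef (w1 w2 w3 L1 L2 L3 x y : R) :
  0 < L1 -> 0 < L2 -> ((L1 + L2 - L3) / 2) ^+ 2 < L1 * L2 ->
  0 < w1 * L1 + w2 * L2 + w3 * L3 -> 0 < w2 * w3 + w1 * w3 + w1 * w2 ->
  (x, y) != (0, 0) -> 0 < w1 * x ^+ 2 + w2 * y ^+ 2 + w3 * (x + y) ^+ 2.
Proof.
move=> L1p L2p D0 T0 W0 nz.
set A := w2 + w3; set B := w1 + w3.
have AB : w3 ^+ 2 < A * B by rewrite /A /B; nra.
have w32 := sqr_ge0 w3.
have Bp : 0 < B.
  rewrite ltNge; apply/negP => B0.
  have An : A < 0 by nra.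
  have Bn : B < 0 by nra.
  set V := w3 * (L1 + L2 - L3); set U := - (A * L2 + B * L1).
  have UV : U < - V by rewrite /U /V /A /B; nra.
  have Up : 0 < U.
    by rewrite oppr_gt0 -[ltRHS]addr0 ltrD// pmulr_llt0.
  have h1 : U ^+ 2 < V ^+ 2 by nra.
  have h2 : 4 * (A * B) * (L1 * L2) <= U ^+ 2.
    by have := sqr_ge0 (A * L2 - B * L1); rewrite /U; nra.
  have h3 : V ^+ 2 <= 4 * (A * B) * (L1 * L2).
    rewrite (_ : V ^+ 2 = 4 * (w3 ^+ 2 * ((L1 + L2 - L3) / 2) ^+ 2)); last by rewrite /V; field.
    rewrite -mulrA ler_pM2l//; apply: ler_pM => //; rewrite ?sqr_ge0 ?ltW//.
  lra.
have Q : B * (w1 * x ^+ 2 + w2 * y ^+ 2 + w3 * (x + y) ^+ 2) =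
   (B * x + w3 * y) ^+ 2 + (A * B - w3 ^+ 2) * y ^+ 2 by rewrite /A /B; ring.
rewrite -(pmulr_rgt0 _ Bp) Q.
rewrite -subr_gt0 in AB.
have [y0|y0] := eqVneq y 0.
  have x0 : x != 0 by apply: contraNneq nz => ->; rewrite y0.
  by rewrite y0 mulr0 expr0n/= mulr0 !addr0 exprn_even_gt0//= mulf_neq0// lt0r_neq0.
by rewrite ltr_wpDl ?sqr_ge0// mulr_gt0// exprn_even_gt0.
Qed.

Lemma euc_form_gt0 (e1 e2 e3 : bool) (r1 r2 r3 h1 h2 h3 b1 b2 b3 : R) :
  0 < r1 -> 0 < r2 -> 0 < r3 ->
  0 < e2%:R * e3%:R + h1 -> 0 < e3%:R * e1%:R + h2 -> 0 < e1%:R * e2%:R + h3 ->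
  0 <= e1%:R * h1 + h2 * h3 -> 0 <= e2%:R * h2 + h3 * h1 ->
  0 <= e3%:R * h3 + h1 * h2 ->
  let x1 := h1 * (r2 * r3) in let x2 := h2 * (r3 * r1) in let x3 := h3 * (r1 * r2) in
  let E1 := e1%:R * r1 ^+ 2 in let E2 := e2%:R * r2 ^+ 2 in let E3 := e3%:R * r3 ^+ 2 in
  let L1 := E2 + E3 + 2 * x1 in
  let L2 := E3 + E1 + 2 * x2 in
  let L3 := E1 + E2 + 2 * x3 in
  ((L1 + L2 - L3) / 2) ^+ 2 < L1 * L2 -> (b2 - b3, b3 - b1) != (0, 0) ->
  0 < euc_form x1 x2 x3 E1 E2 E3 b1 b2 b3.
Proof.
move=> r1p r2p r3p d1 d2 d3 g1 g2 g3 x1 x2 x3 E1 E2 E3 L1 L2 L3 D0 nz.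
have r1n := ltW r1p; have r2n := ltW r2p; have r3n := ltW r3p.
have L1p : 0 < L1 := edge_length_gt0 r2p r3p d1.
have L2p : 0 < L2 := edge_length_gt0 r3p r1p d2.
have L3p : 0 < L3 := edge_length_gt0 r1p r2p d3.
have Z0 : 0 < 2 * E1 * E2 * E3 + 2 * x1 * x2 * x3
   + (E1 * x1 + x2 * x3) * (E2 + E3) + (E2 * x2 + x3 * x1) * (E3 + E1)
   + (E3 * x3 + x1 * x2) * (E1 + E2).
  have w1 := weight_AGM e2 e3 r2p r3p ltr01 ltr01.
  have w2 := weight_AGM e3 e1 r3p r1p ltr01 ltr01.
  have w3 := weight_AGM e1 e2 r1p r2p ltr01 ltr01.
  have m1 := ler_wpM2l (mulr_ge0 g1 (mulr_ge0 (sqr_ge0 r1) (mulr_ge0 r2n r3n))) w1.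
  have m2 := ler_wpM2l (mulr_ge0 g2 (mulr_ge0 (sqr_ge0 r2) (mulr_ge0 r3n r1n))) w2.
  have m3 := ler_wpM2l (mulr_ge0 g3 (mulr_ge0 (sqr_ge0 r3) (mulr_ge0 r1n r2n))) w3.
  apply: lt_le_trans (_ : 0 < 2 * (r1 * r2 * r3) ^+ 2 *
    ((e2%:R * e3%:R + h1) * (e1%:R * e3%:R + h2) * (e1%:R * e2%:R + h3))) _.
    by rewrite (mulrC e1%:R e3%:R) !mulr_gt0 ?exprn_gt0 ?mulr_gt0.
  rewrite -edge_weight_prod -subr_ge0.
  have := lerD (lerD m1 m2) m3; rewrite -subr_ge0.
  congr (is_true (_ <= _)); rewrite /x1 /x2 /x3 /E1 /E2 /E3; ring.
have sum := euc_foot_coord_sum x1 x2 x3 E1 E2 E3; have prod := euc_foot_coord_prod x1 x2 x3 E1 E2 E3.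
rewrite /= -/L1 -/L2 -/L3 in sum prod; move: sum prod; rewrite /euc_form -/L1 -/L2 -/L3.
set N1 := euc_foot_coord x1 _ _ _ _ _; set N2 := euc_foot_coord x2 _ _ _ _ _.
set N3 := euc_foot_coord x3 _ _ _ _ _ => sum prod.
have n1 := lt0r_neq0 L1p; have n2 := lt0r_neq0 L2p; have n3 := lt0r_neq0 L3p.
have -> : (b1 - b2) ^+ 2 = (b2 - b3 + (b3 - b1)) ^+ 2 by ring.
apply: (euc_posdef L1p L2p D0) => //.
  by rewrite !divfK// sum subr_gt0.
rewrite (_ : _ + _ = (N2 * N3 * L1 + N1 * N3 * L2 + N1 * N2 * L3) / (L1 * L2 * L3)).
  by rewrite prod sum divr_gt0 ?mulr_gt0// subr_gt0.
by field; rewrite n1 n2 n3.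
Qed.

End TriangleForms.

(** * Functions that decrease away from finitely many values *)

Section Monotonicity.
Import numFieldNormedType.Exports.
Local Open Scope classical_set_scope.
Local Open Scope ring_scope.
Variable R : realType.
Implicit Types (f g : R -> R) (x y : R).

Lemma between_notin (s : seq R) (a b : R) : a < b ->
  exists v, [/\ a < v, v < b & v \notin s].
Proof.
elim: s a b => [|x s IH] a b ab.
  by exists ((a + b) / 2); rewrite midf_lt ?in_nil//; split => //; lra.
have [/andP[ax xb]|nx] := boolP ((a < x) && (x < b)).
  have [v [av vx vs]] := IH _ _ ax; exists v; split => //.
    exact: lt_trans xb.
  by rewrite inE negb_or vs lt_eqF.
have [v [av vb vs]] := IH _ _ ab; exists v; split => //.
by rewrite inE negb_or vs andbT; apply: contraNneq nx => <-; rewrite av vb.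
Qed.

Lemma is_derive_lt0 g x y (d : R) : is_derive x 1 g d -> d < 0 -> x < y ->
  exists z, [/\ x < z, z < y & g z < g x].
Proof.
move=> [gx gd] d0 xy.
have := gx; rewrite /derivable => gc.
have {gc} gc : (fun h : R => h^-1 *: (g (h *: 1 + x) - g x)) @ 0^' --> d.
  by rewrite -gd; exact: gc.
have : \forall h \near 0^', h^-1 *: (g (h *: 1 + x) - g x) < 0.
  exact: cvgr_lt gc _ d0.
move=> /nbhs_ballP[/= e e0 H].
pose h := Num.min (e / 2) ((y - x) / 2).
have h0 : 0 < h by rewrite lt_min !divr_gt0// subr_gt0.
have he : h < e by rewrite gt_min; apply/orP; left; lra.
have hy : h < y - x by rewrite gt_min; apply/orP; right; lra.
have := H h; rewrite /ball/= sub0r normrN gtr0_norm// => /(_ he).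
rewrite gt_eqF// => /(_ isT).
rewrite pmulr_rlt0 ?invr_gt0// subr_lt0 [h *: 1]mulr1 => gh.
by exists (h + x); split => //; lra.
Qed.

(* Pick a level [v] outside [s] between [g x] and [g 0] for some small [x]; at the
   last point where [g <= v] the derivative is negative, which is absurd. *)
Lemma decreasing_off_finite g (s : seq R) :
  (forall x, 0 <= x <= 1 -> {for x, continuous g}) ->
  (forall x, 0 <= x <= 1 -> g x \notin s -> exists2 d, is_derive x 1 g d & d < 0) ->
  (exists2 d, is_derive (0 : R) 1 g d & d < 0) -> g 1 < g 0.
Proof.
move=> gc gd [d0 g0d d00]; rewrite ltNge; apply/negP => g01.
have [x [x0 x1 gx0]] := is_derive_lt0 g0d d00 ltr01.
have [v [xv v0 vs]] := between_notin s gx0.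
pose A := [set y | x <= y <= 1 /\ g y <= v].
have Ax : A x by split; [rewrite lexx ltW|exact: ltW].
have supA : has_sup A by split; [exists x|exists 1 => y [/andP[]]].
pose z := sup A.
have xz : x <= z by apply: ub_le_sup Ax; exact: supA.2.
have z1 : z <= 1 by apply: ge_sup; [exists x|move=> y [/andP[]]].
have z01 : 0 <= z <= 1 by rewrite z1 andbT; apply: le_trans xz; exact: ltW.
have gz : g z <= v.
  rewrite leNgt; apply/negP => vz.
  have /nbhs_ballP[/= e e0 H] : \forall y \near z, v < g y.
    exact: cvgr_gt (gc _ z01) _ vz.
  have [y Ay zy] := sup_adherent e0 supA.
  have yz : y <= z by apply: ub_le_sup Ay; exact: supA.2.
  have := H y; rewrite /ball/= ger0_norm ?subr_ge0// => /(_ _).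
  rewrite ltrBlDr -ltrBlDl => /(_ _); move: zy; rewrite -/z => zy.
  move=> K; have : v < g y by apply: K; lra.
  by rewrite ltNge Ay.2.
have z1' : z < 1.
  rewrite lt_neqAle z1 andbT; apply/eqP => z1e.
  by move: gz; rewrite z1e leNgt (lt_le_trans v0).
suff [y [zy y1 gy]] : exists y, [/\ z < y, y < 1 & g y <= v].
  suff : y <= z by rewrite leNgt zy.
  apply: ub_le_sup; first exact: supA.2.
  by split => //; rewrite (ltW y1) andbT (le_trans xz)// ltW.
(* If [g z = v], the derivative at [z] is negative since [v] avoids [s]; if [g z < v], continuity
   suffices. Either way [A] contains a point beyond its supremum. *)
move: gz; rewrite le_eqVlt => /orP[/eqP gz|gz].
  have [|d gzd dn] := gd _ z01; first by rewrite gz.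
  have [y [zy y1 gy]] := is_derive_lt0 gzd dn z1'.
  by exists y; split => //; rewrite -gz ltW.
have /nbhs_ballP[/= e e0 H] : \forall y \near z, g y < v.
  exact: cvgr_lt (gc _ z01) _ gz.
pose h := Num.min (e / 2) ((1 - z) / 2).
have h0 : 0 < h by rewrite lt_min !divr_gt0// subr_gt0.
have he : h < e by rewrite gt_min; apply/orP; left; lra.
have hy : h < 1 - z by rewrite gt_min; apply/orP; right; lra.
exists (z + h); split; rewrite ?ltrDl//; first by lra.
apply/ltW/H; rewrite /ball/= opprD addrA subrr sub0r normrN gtr0_norm//.
Qed.

(** * Continuity and derivative of the continued angles *)

Definition clamp x : R := Num.max (-1) (Num.min 1 x).

Lemma clamp_itv x : -1 <= clamp x <= 1.
Proof.
rewrite /clamp le_max lexx/= ge_max ge_min lexx/= andbT.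
by rewrite -subr_ge0 opprK addr_ge0.
Qed.

Lemma clamp_id x : -1 <= x <= 1 -> clamp x = x.
Proof. by move=> /andP[x0 x1]; rewrite /clamp (min_idPr x1) (max_idPr x0). Qed.

Lemma clamp_continuous : continuous clamp.
Proof.
move=> x; rewrite (_ : clamp = (cst (-1)) \max ((cst 1) \min id))//.
apply: continuous_max; first exact: cvg_cst.
by apply: continuous_min; [exact: cvg_cst|exact: cvg_id].
Qed.

(** On [[-1, 1]], [acos] is decreasing and onto [[0, pi]], hence continuous there, and [clamp] takes
    its values in that segment. *)
Lemma acos_clamp_continuous : continuous (@acos R \o clamp).
Proof.
have : {within `[(-1), 1]%classic, continuous (@acos R)}.
  apply: segment_dec_surj_continuous.
    move=> x y; rewrite !in_itv/= => xi yi.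
    rewrite leNgt -ltr_cos ?in_itv/= ?acos_ge0 ?acos_lepi//.
    by rewrite !acosK ?in_itv//= -leNgt.
  rewrite acosN1 acos1 => y/= ; rewrite in_itv/= => yi.
  exists (cos y); first by rewrite /= in_itv/= cos_geN1 cos_le1.
  by rewrite cosK// in_itv.
move=> /subspace_continuousP H x.
apply: (cvg_comp clamp (@acos R) _ (H (clamp x) _)); last first.
  by rewrite /= in_itv/= clamp_itv.
move=> P/= HP; have := @clamp_continuous x _ HP.
rewrite /= !nbhs_simpl/=; apply: filterS => y; apply.
by rewrite /= in_itv/= clamp_itv.
Qed.

(* The angle of cosine [p / sqrt q], continued by 0 and [pi] to degenerate triangles. *)
Definition angle (p q : R) := acos (clamp (p / Num.sqrt q)).

Lemma angle_degenerate (p q : R) : 0 < q -> q <= p ^+ 2 ->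
  angle p q = 0 \/ angle p q = pi.
Proof.
move=> q0 qp; have sq : 0 < Num.sqrt q by rewrite sqrtr_gt0.
have sp : Num.sqrt q <= `|p|.
  by rewrite -sqrtr_sqr ler_wsqrtr.
rewrite /angle; have [p0|p0] := leP 0 p.
  left; suff -> : clamp (p / Num.sqrt q) = 1 by rewrite acos1.
  rewrite /clamp (min_idPl _); first by rewrite (max_idPr _)//; lra.
  by rewrite ler_pdivlMr// mul1r -(ger0_norm p0).
right; suff -> : clamp (p / Num.sqrt q) = -1 by rewrite acosN1.
have h : p / Num.sqrt q <= -1.
  by rewrite ler_pdivrMr// mulN1r lerNr -(ltr0_norm p0).
by rewrite /clamp (min_idPr _) ?(max_idPl _)//; lra.
Qed.

Lemma ratio_itv (p q : R) : p ^+ 2 < q -> -1 < p / Num.sqrt q < 1.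
Proof.
move=> pq; have q0 : 0 < q by apply: le_lt_trans pq; exact: sqr_ge0.
have sq : 0 < Num.sqrt q by rewrite sqrtr_gt0.
rewrite ltr_pdivrMr// ltr_pdivlMr// mul1r mulN1r -ltr_norml.
by rewrite -sqrtr_sqr ltr_sqrt.
Qed.

Lemma is_derive_ratio (P Q : R -> R) (s dP dQ : R) :
  is_derive s 1 P dP -> is_derive s 1 Q dQ -> 0 < Q s ->
  is_derive s 1 (fun t => P t / Num.sqrt (Q t))
    ((dP - P s * (dQ / (2 * Q s))) / Num.sqrt (Q s)).
Proof.
move=> HP HQ Q0.
have sQ : Num.sqrt (Q s) != 0 by rewrite lt0r_neq0// sqrtr_gt0.
have HS := is_derive1_comp (is_derive1_sqrt Q0) HQ.
have HV := @is_deriveV _ (Num.sqrt \o Q) s _ _ sQ HS.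
apply: is_derive_eq (is_deriveM HP HV) _.
rewrite /= -[_ *: _]/(_ * _) -[X in _ + X]/(_ * _) -[X in _ * X]/(_ * _).
have -> : Q s = Num.sqrt (Q s) ^+ 2 by rewrite sqr_sqrtr// ltW.
by rewrite sqrtr_sqr ger0_norm ?sqrtr_ge0//; field.
Qed.

Lemma is_derive_angle (P Q : R -> R) (s dP dQ : R) :
  is_derive s 1 P dP -> is_derive s 1 Q dQ -> P s ^+ 2 < Q s ->
  is_derive s 1 (fun t => angle (P t) (Q t))
    (- (dP - P s * (dQ / (2 * Q s))) / Num.sqrt (Q s - P s ^+ 2)).
Proof.
move=> HP HQ PQ; have Q0 : 0 < Q s by apply: le_lt_trans PQ; exact: sqr_ge0.
have HX := is_derive_ratio HP HQ Q0.
have ri := ratio_itv PQ.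
have HA := @is_derive1_comp _ (@acos R) (fun t => P t / Num.sqrt (Q t)) s _ _
  (is_derive1_acos ri) HX.
(* The ratio stays strictly between -1 and 1 near [s], where [clamp] is the identity. *)
apply: (@near_eq_is_derive _ _ _ (@acos R \o (fun t => P t / Num.sqrt (Q t)))).
  have cX0 : {for s, continuous (fun t => P t / Num.sqrt (Q t))}.
    by apply/differentiable_continuous/derivable1_diffP; exact: ex_derive.
  have cX : P t / Num.sqrt (Q t) @[t --> s] --> P s / Num.sqrt (Q s) := cX0.
  have [ri0 ri1] := andP ri.
  have n0 : \forall t \near s, -1 < P t / Num.sqrt (Q t) := cvgr_gt _ cX _ ri0.
  have n1 : \forall t \near s, P t / Num.sqrt (Q t) < 1 := cvgr_lt _ cX _ ri1.
  near=> t.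
    have t0 : -1 < P t / Num.sqrt (Q t) by near: t; exact: n0.
    have t1 : P t / Num.sqrt (Q t) < 1 by near: t; exact: n1.
    by rewrite /angle clamp_id// (ltW t0) ltW.
apply: is_derive_eq HA _.
have sQ : 0 < Num.sqrt (Q s) by rewrite sqrtr_gt0.
have -> : Num.sqrt (Q s - P s ^+ 2) =
    Num.sqrt (1 - (P s / Num.sqrt (Q s)) ^+ 2) * Num.sqrt (Q s).
  rewrite -sqrtrM; last first.
    rewrite subr_ge0 -real_normK ?num_real// exprn_ile1//.
    by rewrite ler_norml !ltW//; have [] := andP ri.
  by rewrite mulrBl mul1r exprMn exprVn sqr_sqrtr ?ltW// divfK// lt0r_neq0.
set A := Num.sqrt (1 - _); set D := dP - _.
by rewrite (invfM A); ring.
Unshelve. all: by end_near. Qed.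

Lemma angle_continuous (P Q : R -> R) (s dP dQ : R) :
  is_derive s 1 P dP -> is_derive s 1 Q dQ -> 0 < Q s ->
  {for s, continuous (fun t => angle (P t) (Q t))}.
Proof.
move=> HP HQ Q0; have HX := is_derive_ratio HP HQ Q0.
have cX : {for s, continuous (fun t => P t / Num.sqrt (Q t))}.
  by apply/differentiable_continuous/derivable1_diffP; exact: ex_derive.
exact: continuous_comp cX (@acos_clamp_continuous _).
Qed.

(** The three quantities [S_j S_k - P_i ^ 2] coincide, so the three angles degenerate
    simultaneously. Where this common discriminant is positive, [angle_speed] gives a negative
    derivative; elsewhere every angle is 0 or [pi]. *)
Lemma triangle_angle_mono (P1 P2 P3 S1 S2 S3 dP1 dP2 dP3 dS1 dS2 dS3 : R -> R)
    (b1 b2 b3 : R) :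
  (forall s : R, 0 <= s <= 1 ->
    [/\ is_derive s 1 P1 (dP1 s), is_derive s 1 P2 (dP2 s) & is_derive s 1 P3 (dP3 s)] /\
    [/\ is_derive s 1 S1 (dS1 s), is_derive s 1 S2 (dS2 s) & is_derive s 1 S3 (dS3 s)]) ->
  (forall s : R, 0 <= s <= 1 -> [/\ 0 < S1 s, 0 < S2 s & 0 < S3 s]) ->
  (forall s : R, 0 <= s <= 1 -> S2 s * S3 s - P1 s ^+ 2 = S1 s * S2 s - P3 s ^+ 2) ->
  (forall s : R, 0 <= s <= 1 -> S3 s * S1 s - P2 s ^+ 2 = S1 s * S2 s - P3 s ^+ 2) ->
  (forall s : R, 0 <= s <= 1 -> 0 < S1 s * S2 s - P3 s ^+ 2 ->
    0 < angle_speed b1 b2 b3 (P1 s) (P2 s) (P3 s) (S1 s) (S2 s) (S3 s)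
          (dP1 s) (dP2 s) (dP3 s) (dS1 s) (dS2 s) (dS3 s)) ->
  0 < S1 0 * S2 0 - P3 0 ^+ 2 ->
  let g (s : R) := b1 * angle (P1 s) (S2 s * S3 s) + b2 * angle (P2 s) (S3 s * S1 s)
             + b3 * angle (P3 s) (S1 s * S2 s) in
  is_true (g 1 < g 0).
Proof.
move=> dPS S0 D1 D2 W D0 g.
have h01 : (0 <= (0 : R)) && ((0 : R) <= 1) by apply/andP; split.
pose ends : seq R := [:: 0; pi].
(* The possible values of [g] at degenerate triangles form a finite list independent of [s], because
   the velocity [b] is constant. *)
pose vals := [seq b1 * x + y | x : R <- ends,
  y : R <- [seq b2 * x + b3 * y | x : R <- ends, y : R <- ends]].
have drv (s : R) : 0 <= s <= 1 -> 0 < S1 s * S2 s - P3 s ^+ 2 ->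
    exists2 d, is_derive s 1 g d & d < 0.
  move=> hs Ds; have [[dp1 dp2 dp3] [ds1 ds2 ds3]] := dPS _ hs.
  have [s1 s2 s3] := S0 _ hs.
  have := is_derive_angle dp1 (is_deriveM ds2 ds3) _.
  rewrite -subr_gt0 (D1 _ hs) => /(_ Ds) a1.
  have := is_derive_angle dp2 (is_deriveM ds3 ds1) _.
  rewrite -subr_gt0 (D2 _ hs) => /(_ Ds) a2.
  have := is_derive_angle dp3 (is_deriveM ds1 ds2) _.
  rewrite -subr_gt0 => /(_ Ds) a3.
  have := is_deriveD (is_deriveD (is_deriveZ b1 a1) (is_deriveZ b2 a2)) (is_deriveZ b3 a3).
  set d := (X in is_derive _ _ _ X) => dg.
  exists d; first exact: dg.
  have -> : d = - angle_speed b1 b2 b3 (P1 s) (P2 s) (P3 s) (S1 s) (S2 s) (S3 s)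
          (dP1 s) (dP2 s) (dP3 s) (dS1 s) (dS2 s) (dS3 s)
          / Num.sqrt (S1 s * S2 s - P3 s ^+ 2).
    have n : Num.sqrt (S1 s * S2 s - P3 s ^+ 2) != 0 by rewrite lt0r_neq0// sqrtr_gt0.
    rewrite /d /angle_speed /GRing.scale/=.
    have fM (f h : R -> R) : (f * h) s = f s * h s by [].
    by rewrite !fM; field; rewrite n !lt0r_neq0.
  by rewrite mulNr oppr_lt0 divr_gt0 ?W// sqrtr_gt0.
apply: (@decreasing_off_finite g vals); last exact: drv h01 D0.
  move=> s hs; have [[dp1 dp2 dp3] [ds1 ds2 ds3]] := dPS _ hs.
  have [s1 s2 s3] := S0 _ hs.
  have a1 := angle_continuous dp1 (is_deriveM ds2 ds3) (mulr_gt0 s2 s3).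
  have a2 := angle_continuous dp2 (is_deriveM ds3 ds1) (mulr_gt0 s3 s1).
  have a3 := angle_continuous dp3 (is_deriveM ds1 ds2) (mulr_gt0 s1 s2).
  by apply: cvgD; [apply: cvgD|]; apply: cvgZr.
move=> s hs gs; apply: (drv _ hs); rewrite ltNge; apply: contra gs => Ds.
have [s1 s2 s3] := S0 _ hs.
have deg p q : 0 < q -> q - p ^+ 2 <= 0 -> angle p q \in ends.
  move=> q0; rewrite subr_le0 => qp; rewrite !inE.
  by have [->|->] := angle_degenerate q0 qp; rewrite eqxx ?orbT.
rewrite /g -addrA; apply: (allpairs_f (fun x y => b1 * x + y)).
  by apply: deg; rewrite ?mulr_gt0// D1.
apply: (allpairs_f (fun x y => b2 * x + b3 * y)); apply: deg; rewrite ?mulr_gt0//.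
by rewrite D2.
Qed.

End Monotonicity.

(** * Angles of a triangle along a path of factors *)

Section TriangleAngles.
Import numFieldNormedType.Exports.
Local Open Scope classical_set_scope.
Local Open Scope ring_scope.
Variable R : realType.

(** * Laws of cosines and nondegeneracy *)

Lemma dot_ge0 (u : 'rV[R]_2) : 0 <= dot u u.
Proof. by rewrite /dot -!expr2 addr_ge0 ?sqr_ge0. Qed.

Lemma sqr_euc_norm (u : 'rV[R]_2) : euc_norm u ^+ 2 = dot u u.
Proof. by rewrite sqr_sqrtr// dot_ge0. Qed.

Lemma angle_itv (p q : R) : p ^+ 2 < q -> angle p q = acos (p / Num.sqrt q).
Proof.
by move=> /ratio_itv/andP[h0 h1]; rewrite /angle clamp_id// !ltW.
Qed.

(** The law of cosines leaves one possible value, and an explicit triangle with a vertex at the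
    origin and a side on the first axis attains it; hence [xget] returns it rather than its
    default. *)
Lemma inner_angle_euclidean (a b c : R) : 0 < a -> 0 < b -> 0 <= c ->
  ((a ^+ 2 + b ^+ 2 - c ^+ 2) / 2) ^+ 2 < a ^+ 2 * b ^+ 2 ->
  inner_angle Euclidean a b c =
  angle ((a ^+ 2 + b ^+ 2 - c ^+ 2) / 2) (a ^+ 2 * b ^+ 2).
Proof.
move=> a0 b0 c0 D; rewrite angle_itv//.
have ri := ratio_itv D.
have sq : Num.sqrt (a ^+ 2 * b ^+ 2) = a * b.
  by rewrite -exprMn sqrtr_sqr ger0_norm// mulr_ge0// ltW.
rewrite sq in ri *; set X := _ / (a * b) in ri *.
rewrite /inner_angle; set T := (X in xget 0 X).
have TX th : T th -> th = acos X.
  move=> [p [q [r [pq pr qr ->]]]]; rewrite /euc_angle.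
  rewrite /euc_dist in pq pr qr; rewrite pq pr; congr (acos (_ / _)).
  rewrite -pq -pr -qr !sqr_euc_norm /dot !mxE; by field.
have Xe : a * b * X = (a ^+ 2 + b ^+ 2 - c ^+ 2) / 2.
  by rewrite /X mulrC divfK// lt0r_neq0// mulr_gt0.
apply: (xget_unique _ _ TX); clearbody X.
pose q : 'rV[R]_2 := \row_j [:: a; 0]`_j.
pose r : 'rV[R]_2 := \row_j [:: b * X; b * Num.sqrt (1 - X ^+ 2)]`_j.
have s1 : Num.sqrt (1 - X ^+ 2) ^+ 2 = 1 - X ^+ 2.
  by rewrite sqr_sqrtr//; have /andP[] := ri; nra.
have q1 : euc_norm (q - 0) = a.
  rewrite /euc_norm /dot !mxE/= !subr0 mulr0 addr0 -expr2 sqrtr_sqr ger0_norm//.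
  exact: ltW.
have q2 : euc_norm (r - 0) = b.
  rewrite /euc_norm /dot !mxE/= !subr0.
  rewrite (_ : _ + _ = b ^+ 2) ?sqrtr_sqr ?gtr0_norm//.
  by rewrite -!expr2 !exprMn s1; ring.
exists 0, q, r; split => //.
  rewrite /euc_dist /euc_norm /dot !mxE/=.
  rewrite (_ : _ + _ = c ^+ 2) ?sqrtr_sqr ?ger0_norm// subr0 -!expr2 !exprMn s1.
  have -> : c ^+ 2 = a ^+ 2 + b ^+ 2 - 2 * (a * b * X) by rewrite Xe; field.
  ring.
rewrite /euc_angle q1 q2; congr (acos _).
rewrite /dot !mxE/= !subr0 mul0r addr0 mulrA; field.
by rewrite !lt0r_neq0.
Qed.

(** The reverse Cauchy-Schwarz inequality, by which [arcosh] can be inverted in [hyp_dist]. *)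
Lemma mink_leN1 (u v : 'rV[R]_3) : hyp_plane u -> hyp_plane v -> 1 <= - mink u v.
Proof.
rewrite /hyp_plane /mink => -[hu u0] [hv v0].
set a := u 0 0 in hu u0 *; set b := u 0 1 in hu *; set c := u 0 2 in hu *.
set a' := v 0 0 in hv v0 *; set b' := v 0 1 in hv *; set c' := v 0 2 in hv *.
have aa : 0 < a * a' by rewrite mulr_gt0.
suff : `|1 + b * b' + c * c'| <= a * a' by rewrite ler_norml => /andP[_]; lra.
rewrite -ler_sqr ?nnegrE ?(ltW aa)// real_normK ?num_real//.
have e1 : a ^+ 2 = 1 + b ^+ 2 + c ^+ 2 by rewrite !expr2; lra.
have e2 : a' ^+ 2 = 1 + b' ^+ 2 + c' ^+ 2 by rewrite !expr2; lra.
rewrite exprMn e1 e2.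
have := sqr_ge0 (b - b'); have := sqr_ge0 (c - c'); have := sqr_ge0 (b * c' - c * b').
nra.
Qed.

Lemma hyp_dist_arcosh (u v : 'rV[R]_3) (c : R) : hyp_plane u -> hyp_plane v ->
  1 < c -> hyp_dist u v = arcosh c -> mink u v = - c.
Proof.
move=> hu hv c1; rewrite /hyp_dist => /(congr1 cosh).
by rewrite !arcoshK ?mink_leN1// ?ltW// => <-; rewrite opprK.
Qed.

(** As in the Euclidean case: [mdir] yields the hyperbolic law of cosines, and the triangle is
    realized with the apex at [(1, 0, 0)]. *)
Lemma inner_angle_hyperbolic (c1 c2 c3 : R) : 1 < c1 -> 1 < c2 -> 1 < c3 ->
  (c2 * c3 - c1) ^+ 2 < (c2 ^+ 2 - 1) * (c3 ^+ 2 - 1) ->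
  inner_angle Hyperbolic (arcosh c3) (arcosh c2) (arcosh c1) =
  angle (c2 * c3 - c1) ((c2 ^+ 2 - 1) * (c3 ^+ 2 - 1)).
Proof.
move=> h1 h2 h3 D; rewrite angle_itv//.
have ri := ratio_itv D.
have s2 := sqrB1_gt0 h2; have s3 := sqrB1_gt0 h3.
have sq : Num.sqrt ((c2 ^+ 2 - 1) * (c3 ^+ 2 - 1)) =
  Num.sqrt (c3 ^+ 2 - 1) * Num.sqrt (c2 ^+ 2 - 1) by rewrite mulrC sqrtrM// ltW.
rewrite sq in ri *; set t2 := Num.sqrt (c2 ^+ 2 - 1) in ri *.
set t3 := Num.sqrt (c3 ^+ 2 - 1) in ri *.
set X := _ / (t3 * t2) in ri *.
have t2p : 0 < t2 by rewrite sqrtr_gt0.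
have t3p : 0 < t3 by rewrite sqrtr_gt0.
have t2e : t2 ^+ 2 = c2 ^+ 2 - 1 by rewrite sqr_sqrtr// ltW.
have t3e : t3 ^+ 2 = c3 ^+ 2 - 1 by rewrite sqr_sqrtr// ltW.
have mdir (p q r : 'rV[R]_3) : mink p p = -1 ->
    mink (hyp_dir p q) (hyp_dir p r) = mink q r + mink p q * mink p r.
  move=> pp; rewrite (_ : mink (hyp_dir p q) _ = mink q r
    + mink p q * mink p r * (2 + mink p p)); first by rewrite pp; ring.
  by rewrite /hyp_dir /mink !mxE; ring.
rewrite /inner_angle; set T := (X in xget 0 X).
have TX th : T th -> th = acos X.
  move=> [p [q [r [[hp hq hr] [pq pr qr ->]]]]].
  have mpq := hyp_dist_arcosh hp hq h3 pq.
  have mpr := hyp_dist_arcosh hp hr h2 pr.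
  have mqr := hyp_dist_arcosh hq hr h1 qr.
  rewrite /hyp_angle /mink_norm !mdir ?(proj1 hp)// (proj1 hq) (proj1 hr) mqr mpq mpr.
  rewrite /X /t2 /t3; congr (acos (_ / (Num.sqrt _ * Num.sqrt _))); ring.
have Xe : t3 * t2 * X = c2 * c3 - c1.
  by rewrite /X mulrC divfK// lt0r_neq0// mulr_gt0.
apply: (xget_unique _ _ TX); clearbody X.
pose p : 'rV[R]_3 := \row_j [:: 1; 0; 0]`_j.
pose q : 'rV[R]_3 := \row_j [:: c3; t3; 0]`_j.
pose r : 'rV[R]_3 := \row_j [:: c2; t2 * X; t2 * Num.sqrt (1 - X ^+ 2)]`_j.
have s1 : Num.sqrt (1 - X ^+ 2) ^+ 2 = 1 - X ^+ 2.
  by rewrite sqr_sqrtr//; have /andP[] := ri; nra.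
have pp : mink p p = -1 by rewrite /mink !mxE/=; ring.
have qq : mink q q = -1 by rewrite /mink !mxE/= -!expr2 t3e; ring.
have rr : mink r r = -1 by rewrite /mink !mxE/= -!expr2 !exprMn s1 t2e; ring.
have pq : mink p q = - c3 by rewrite /mink !mxE/=; ring.
have pr : mink p r = - c2 by rewrite /mink !mxE/=; ring.
have qr : mink q r = - c1.
  rewrite /mink !mxE/= (_ : _ - _ = t3 * t2 * X - c2 * c3); last by ring.
  by rewrite Xe; ring.
exists p, q, r; split; first split; split; rewrite /hyp_dist ?pq ?pr ?qr ?opprK//.
- by rewrite mxE.
- by rewrite mxE/= (lt_trans ltr01).
- by rewrite mxE/= (lt_trans ltr01).
rewrite /hyp_angle /mink_norm !mdir// pq pr qr qq rr.
rewrite (_ : -1 + - c3 * - c3 = c3 ^+ 2 - 1); last by ring.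
rewrite (_ : -1 + - c2 * - c2 = c2 ^+ 2 - 1); last by ring.
rewrite -/t2 -/t3 (_ : - c1 + - c3 * - c2 = t3 * t2 * X); last by rewrite Xe; ring.
by rewrite mulrC mulKf// lt0r_neq0// mulr_gt0.
Qed.

(** Heron's factorization. *)
Lemma euclidean_nondegenerate (l1 l2 l3 : R) : 0 < l1 -> 0 < l2 -> 0 < l3 ->
  l1 < l2 + l3 -> l2 < l3 + l1 -> l3 < l1 + l2 ->
  ((l1 ^+ 2 + l2 ^+ 2 - l3 ^+ 2) / 2) ^+ 2 < l1 ^+ 2 * l2 ^+ 2.
Proof.
move=> p1 p2 p3 h1 h2 h3; rewrite -subr_gt0.
rewrite (_ : _ - _ = (l1 + l2 + l3) * (l2 + l3 - l1) * (l3 + l1 - l2) * (l1 + l2 - l3) / 4).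
  by rewrite divr_gt0// !mulr_gt0 ?subr_gt0// !addr_gt0.
by field.
Qed.

(** In terms of the exponentials [t_i] of the lengths, the determinant factors as in Heron's
    formula, and the triangle inequalities become [t_i < t_j t_k]. *)
Lemma hyperbolic_nondegenerate (c1 c2 c3 : R) : 1 < c1 -> 1 < c2 -> 1 < c3 ->
  arcosh c1 < arcosh c2 + arcosh c3 -> arcosh c2 < arcosh c3 + arcosh c1 ->
  arcosh c3 < arcosh c1 + arcosh c2 -> 0 < cosh_gram_det c1 c2 c3.
Proof.
move=> h1 h2 h3; rewrite /arcosh.
have t (c : R) : 1 < c -> let t := c + Num.sqrt (c ^+ 2 - 1) in
    1 < t /\ c = (t + t^-1) / 2.
  move=> hc /=; set s := Num.sqrt _; have s0 : 0 <= s by exact: sqrtr_ge0.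
  have se : s ^+ 2 = c ^+ 2 - 1 by rewrite sqr_sqrtr// ltW// sqrB1_gt0.
  split; first by lra.
  have cs : c + s != 0 by rewrite lt0r_neq0//; lra.
  suff -> : (c + s)^-1 = c - s by field.
  by apply: (mulfI cs); rewrite divff//; ring: se.
have [t1 e1] := t _ h1; have [t2 e2] := t _ h2; have [t3 e3] := t _ h3.
move: t1 e1 t2 e2 t3 e3; set t1 := c1 + _; set t2 := c2 + _; set t3 := c3 + _.
move=> t1p -> t2p -> t3p ->.
have p1 : 0 < t1 by lra.
have p2 : 0 < t2 by lra.
have p3 : 0 < t3 by lra.
rewrite -!lnM ?posrE// !ltr_ln ?posrE ?mulr_gt0// => k1 k2 k3.
rewrite (_ : cosh_gram_det _ _ _ = (t1 * t2 * t3 - 1) * (t2 * t3 - t1) * (t3 * t1 - t2)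
  * (t1 * t2 - t3) / (4 * (t1 ^+ 2 * t2 ^+ 2 * t3 ^+ 2))).
  rewrite divr_gt0 ?mulr_gt0 ?exprn_gt0 ?subr_gt0//.
  by rewrite -(mulr1 1) ltr_pM// -(mulr1 1) ltr_pM.
rewrite /cosh_gram_det; field; rewrite !lt0r_neq0//.
Qed.

(* [du / df = 1 / sqrt (1 + eps e^(2f))] in the hyperbolic case, so that
   [dr / du = r sqrt (1 + eps r ^ 2)] for [r = e^f]. *)
Definition ucoord (g : geometry) (e : bool) (f : R) : R :=
  if g is Hyperbolic then
    if e then - ln (expR (- f) + Num.sqrt (1 + expR (- f) ^+ 2)) else f
  else f.

(** For hyperbolic weight 1, [u = - arsinh (e^(-f))], so that [e^f = 1 / sinh (- u)]. *)
Definition radius (g : geometry) (e : bool) (u : R) : R :=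
  if g is Hyperbolic then
    if e then 2 / (expR (- u) - expR u) else expR u
  else expR u.

(** In the hyperbolic case this is [C = sqrt (1 + eps r ^ 2)], that is [coth (- u)] for weight 1.
    The Euclidean value 1 makes [dr / du = r C] valid in both geometries. *)
Definition coshr (g : geometry) (e : bool) (u : R) : R :=
  if g is Hyperbolic then
    if e then (expR (- u) + expR u) / (expR (- u) - expR u) else 1
  else 1.

(** The range of [ucoord]; it is convex and so contains the segment joining two factors. *)
Definition udomain (g : geometry) (e : bool) (u : R) : bool :=
  if g is Hyperbolic then e ==> (u < 0) else true.

Lemma ucoord_domain g e f : udomain g e (ucoord g e f).
Proof.
case: g e => [|[]]//=; rewrite oppr_lt0 ln_gt0//.
have := expR_gt0 (- f); set x := expR _ => x0.
have : 1 <= Num.sqrt (1 + x ^+ 2).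
  by rewrite -[leLHS]sqrtr1 ler_wsqrtr// lerDl sqr_ge0.
lra.
Qed.

Lemma radius_ucoord g e f : radius g e (ucoord g e f) = expR f.
Proof.
case: g e => [|[]]//=; rewrite opprK [expR (- ln _)]expRN.
have := expR_gt0 (- f); set x := expR _ => x0.
set s := Num.sqrt _; have s0 : 0 <= s by exact: sqrtr_ge0.
have se : s ^+ 2 = 1 + x ^+ 2 by rewrite sqr_sqrtr// addr_ge0 ?sqr_ge0.
have xs : 0 < x + s by lra.
rewrite lnK ?posrE//.
suff -> : (x + s)^-1 = s - x.
  rewrite (_ : x + s - (s - x) = 2 * x); last by ring.
  rewrite -[RHS](invrK) -expRN -/x; field; exact: lt0r_neq0.
by apply: (mulfI (lt0r_neq0 xs)); rewrite divff ?lt0r_neq0//; ring: se.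
Qed.

Lemma ucoord_inj g e : injective (ucoord g e).
Proof.
by move=> f f' /(congr1 (radius g e)); rewrite !radius_ucoord => /expR_inj.
Qed.

Lemma expRNB_gt0 (u : R) : u < 0 -> 0 < expR (- u) - expR u.
Proof. by move=> u0; rewrite subr_gt0 ltr_expR; lra. Qed.

Lemma radius_gt0 g e u : udomain g e u -> 0 < radius g e u.
Proof.
case: g e => [|[]]/=; rewrite ?expR_gt0// => u0.
by rewrite divr_gt0// expRNB_gt0.
Qed.

Lemma coshr_gt0 g e u : udomain g e u -> 0 < coshr g e u.
Proof.
case: g e => [|[]]//= u0.
by apply: divr_gt0; [rewrite addr_gt0 ?expR_gt0|exact: expRNB_gt0].
Qed.

Lemma sqr_coshr e u : udomain Hyperbolic e u ->
  coshr Hyperbolic e u ^+ 2 = 1 + e%:R * radius Hyperbolic e u ^+ 2.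
Proof.
case: e => /= u0; last by rewrite mul0r addr0 expr1n.
have : expR (- u) - expR u != 0 by exact/lt0r_neq0/expRNB_gt0.
rewrite expRN; have := expR_gt0 u; set x := expR u => x0 n.
have x0' := lt0r_neq0 x0.
have xx : x^-1 - x = (1 - x ^+ 2) / x by field.
have n2 : 1 - x ^+ 2 != 0 by apply: contraNneq n => n0; rewrite xx n0 mul0r.
by field; rewrite x0' mulNr -expr2.
Qed.

Lemma is_derive_affine (u b s : R) : is_derive s 1 (fun t => u + t * b) b.
Proof.
apply: is_derive_eq (is_deriveD (is_derive_cst u s 1) (is_deriveM (is_derive_id s 1) (is_derive_cst b s 1))) _.
by rewrite add0r /GRing.scale/= mulr0 add0r mulr1.
Qed.

Lemma is_derive_radius g e (u b s : R) : udomain g e (u + s * b) ->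
  is_derive s 1 (fun t => radius g e (u + t * b))
    (radius g e (u + s * b) * coshr g e (u + s * b) * b).
Proof.
have da := is_derive_affine u b s.
have de := @is_derive1_comp _ expR (fun t => u + t * b) s _ _
  (is_derive_expR (u + s * b)) da.
case: g => /= u0; first by rewrite mulr1; exact: de.
case: e u0 => /= u0; last by rewrite mulr1; exact: de.
have den := @is_derive1_comp _ expR (fun t => - (u + t * b)) s _ _
  (is_derive_expR (- (u + s * b))) (is_deriveN da).
have n : expR (- (u + s * b)) - expR (u + s * b) != 0.
  exact/lt0r_neq0/expRNB_gt0.
have dd := @is_deriveV _ (fun t => expR (- (u + t * b)) - expR (u + t * b)) s _ _ n (is_deriveB den de).
have dM := is_deriveM (is_derive_cst (2 : R) s 1) dd.
apply: (is_derive_eq dM).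
rewrite /GRing.scale/=; field; exact: n.
Qed.

Lemma is_derive_coshr e (u b s : R) : udomain Hyperbolic e (u + s * b) ->
  is_derive s 1 (fun t => coshr Hyperbolic e (u + t * b))
    (e%:R * radius Hyperbolic e (u + s * b) ^+ 2 * b).
Proof.
case: e => /= u0; last first.
  by rewrite !mul0r; exact: is_derive_cst.
have da := is_derive_affine u b s.
have de := @is_derive1_comp _ expR (fun t => u + t * b) s _ _
  (is_derive_expR (u + s * b)) da.
have den := @is_derive1_comp _ expR (fun t => - (u + t * b)) s _ _
  (is_derive_expR (- (u + s * b))) (is_deriveN da).
have n : expR (- (u + s * b)) - expR (u + s * b) != 0.
  exact/lt0r_neq0/expRNB_gt0.
have dd := @is_deriveV _ (fun t => expR (- (u + t * b)) - expR (u + t * b)) s _ _ n (is_deriveB den de).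
apply: is_derive_eq (is_deriveM (is_deriveD den de) dd) _.
rewrite /GRing.scale/=.
have : expR (u + s * b) * expR (- (u + s * b)) = 1 by rewrite expRxMexpNx_1.
move: n; set x := expR (u + _); set y := expR (- _) => n xy.
rewrite (_ : (_ + _) s = y + x)//.
rewrite (_ : 1 * (2 / (y - x)) ^+ 2 * b = 4 * (x * y) * b / (y - x) ^+ 2); last by rewrite xy; field.
by field.
Qed.

(** * Monotonicity on one triangle along a path of constant velocity *)

Definition hyp_path (e : bool) (b : R) (r C : R -> R) := forall s : R, 0 <= s <= 1 ->
  [/\ is_derive s 1 r (r s * C s * b), is_derive s 1 C (e%:R * r s ^+ 2 * b),
      0 < r s, 0 < C s & C s ^+ 2 = 1 + e%:R * r s ^+ 2].

(** An instance of [triangle_angle_mono] whose common discriminant is [cosh_gram_det]; its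
    derivative condition is [hyp_form_gt0]. *)
Lemma hyp_triangle_mono (e1 e2 e3 : bool) (h1 h2 h3 b1 b2 b3 : R)
    (r1 r2 r3 C1 C2 C3 : R -> R) :
  hyp_path e1 b1 r1 C1 -> hyp_path e2 b2 r2 C2 -> hyp_path e3 b3 r3 C3 ->
  0 < e2%:R * e3%:R + h1 -> 0 < e3%:R * e1%:R + h2 -> 0 < e1%:R * e2%:R + h3 ->
  0 <= e1%:R * h1 + h2 * h3 -> 0 <= e2%:R * h2 + h3 * h1 ->
  0 <= e3%:R * h3 + h1 * h2 -> (b1, b2, b3) != (0, 0, 0) ->
  let c1 s := C2 s * C3 s + h1 * (r2 s * r3 s) in
  let c2 s := C3 s * C1 s + h2 * (r3 s * r1 s) in
  let c3 s := C1 s * C2 s + h3 * (r1 s * r2 s) in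
  let th s := b1 * angle (c2 s * c3 s - c1 s) ((c2 s ^+ 2 - 1) * (c3 s ^+ 2 - 1))
    + b2 * angle (c3 s * c1 s - c2 s) ((c3 s ^+ 2 - 1) * (c1 s ^+ 2 - 1))
    + b3 * angle (c1 s * c2 s - c3 s) ((c1 s ^+ 2 - 1) * (c2 s ^+ 2 - 1)) in
  0 < cosh_gram_det (c1 0) (c2 0) (c3 0) -> is_true (th 1 < th 0).
Proof.
move=> p1 p2 p3 d1 d2 d3 g1 g2 g3 nz c1 c2 c3 th D0.
pose dc1 s := (C2 s * c1 s - C3 s) * b2 + (C3 s * c1 s - C2 s) * b3.
pose dc2 s := (C3 s * c2 s - C1 s) * b3 + (C1 s * c2 s - C3 s) * b1.
pose dc3 s := (C1 s * c3 s - C2 s) * b1 + (C2 s * c3 s - C1 s) * b2.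
have dcos (e e' : bool) (h b b' : R) (r r' C C' : R -> R) (s : R) :
    hyp_path e b r C -> hyp_path e' b' r' C' -> 0 <= s <= 1 ->
    is_derive s 1 (fun t => C t * C' t + h * (r t * r' t))
      ((C s * (C s * C' s + h * (r s * r' s)) - C' s) * b
       + (C' s * (C s * C' s + h * (r s * r' s)) - C s) * b').
  move=> H H' hs; have [dr dC r0 C0 q] := H _ hs; have [dr' dC' r0' C0' q'] := H' _ hs.
  apply: is_derive_eq (is_deriveD (is_deriveM dC dC') (is_deriveZ h (is_deriveM dr dr'))) _.
  rewrite /GRing.scale/=.
  have -> : e%:R * r s ^+ 2 = C s ^+ 2 - 1 by rewrite q; ring.
  have -> : e'%:R * r' s ^+ 2 = C' s ^+ 2 - 1 by rewrite q'; ring.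
  ring.
have gt1 (e e' : bool) (h b b' : R) (r r' C C' : R -> R) (s : R) :
    hyp_path e b r C -> hyp_path e' b' r' C' -> 0 < e%:R * e'%:R + h -> 0 <= s <= 1 ->
    1 < C s * C' s + h * (r s * r' s).
  move=> H H' d hs; have [_ _ r0 C0 q] := H _ hs; have [_ _ r0' C0' q'] := H' _ hs.
  exact: edge_cosh_gt1 q q' d.
have dprod (c c' c'' : R -> R) (dc dc' dc'' s : R) : is_derive s 1 c dc ->
    is_derive s 1 c' dc' -> is_derive s 1 c'' dc'' ->
    is_derive s 1 (fun t => c t * c' t - c'' t) (dc * c' s + c s * dc' - dc'').
  move=> k k' k''; apply: is_derive_eq (is_deriveB (is_deriveM k k') k'') _.
  by rewrite /GRing.scale/=; ring.
have dsqr (c : R -> R) (dc s : R) : is_derive s 1 c dc ->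
    is_derive s 1 (fun t => c t ^+ 2 - 1) (2 * c s * dc).
  move=> k; have -> : (fun t => c t ^+ 2 - 1) = c * c - cst 1.
    by apply/funext => t; rewrite expr2.
  apply: is_derive_eq (is_deriveB (is_deriveM k k) (is_derive_cst (1 : R) s 1)) _.
  by rewrite /GRing.scale/=; ring.
apply: (@triangle_angle_mono R (fun s => c2 s * c3 s - c1 s)
  (fun s => c3 s * c1 s - c2 s) (fun s => c1 s * c2 s - c3 s)
  (fun s => c1 s ^+ 2 - 1) (fun s => c2 s ^+ 2 - 1) (fun s => c3 s ^+ 2 - 1)
  (fun s => dc2 s * c3 s + c2 s * dc3 s - dc1 s)
  (fun s => dc3 s * c1 s + c3 s * dc1 s - dc2 s)
  (fun s => dc1 s * c2 s + c1 s * dc2 s - dc3 s)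
  (fun s => 2 * c1 s * dc1 s) (fun s => 2 * c2 s * dc2 s) (fun s => 2 * c3 s * dc3 s)
  b1 b2 b3) => [s hs|s hs|s hs|s hs|s hs|].
- have k1 := dcos _ _ h1 _ _ _ _ _ _ _ p2 p3 hs.
  have k2 := dcos _ _ h2 _ _ _ _ _ _ _ p3 p1 hs.
  have k3 := dcos _ _ h3 _ _ _ _ _ _ _ p1 p2 hs.
  by split; split; [exact: dprod|exact: dprod|exact: dprod|exact: dsqr|exact: dsqr|exact: dsqr].
- by split; apply: sqrB1_gt0; [exact: gt1 p2 p3 d1 hs|exact: gt1 p3 p1 d2 hs|exact: gt1 p1 p2 d3 hs].
- by ring.
- by ring.
- move=> Ds; rewrite hyp_angle_speed.
  + have [_ _ r1p C1p q1] := p1 _ hs; have [_ _ r2p C2p q2] := p2 _ hs.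
    have [_ _ r3p C3p q3] := p3 _ hs.
    apply: (hyp_form_gt0 r1p r2p r3p C1p C2p C3p q1 q2 q3 d1 d2 d3 g1 g2 g3) => //.
    rewrite -/(c1 s) -/(c2 s) -/(c3 s) (_ : cosh_gram_det _ _ _ = (c1 s ^+ 2 - 1) * (c2 s ^+ 2 - 1) - (c1 s * c2 s - c3 s) ^+ 2)//.
    by rewrite /cosh_gram_det; ring.
  + exact/lt0r_neq0/sqrB1_gt0/(gt1 _ _ _ _ _ _ _ _ _ _ p2 p3 d1 hs).
  + exact/lt0r_neq0/sqrB1_gt0/(gt1 _ _ _ _ _ _ _ _ _ _ p3 p1 d2 hs).
  + exact/lt0r_neq0/sqrB1_gt0/(gt1 _ _ _ _ _ _ _ _ _ _ p1 p2 d3 hs).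
- by rewrite (_ : _ - _ = cosh_gram_det (c1 0) (c2 0) (c3 0))// /cosh_gram_det; ring.
Qed.

Definition euc_path (b : R) (r : R -> R) := forall s : R, 0 <= s <= 1 ->
  is_derive s 1 r (r s * b) /\ 0 < r s.

Lemma euc_triangle_mono (e1 e2 e3 : bool) (h1 h2 h3 b1 b2 b3 : R)
    (r1 r2 r3 : R -> R) :
  euc_path b1 r1 -> euc_path b2 r2 -> euc_path b3 r3 ->
  0 < e2%:R * e3%:R + h1 -> 0 < e3%:R * e1%:R + h2 -> 0 < e1%:R * e2%:R + h3 ->
  0 <= e1%:R * h1 + h2 * h3 -> 0 <= e2%:R * h2 + h3 * h1 ->
  0 <= e3%:R * h3 + h1 * h2 -> (b2 - b3, b3 - b1) != (0, 0) ->
  let L1 s := e2%:R * r2 s ^+ 2 + e3%:R * r3 s ^+ 2 + 2 * (h1 * (r2 s * r3 s)) in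
  let L2 s := e3%:R * r3 s ^+ 2 + e1%:R * r1 s ^+ 2 + 2 * (h2 * (r3 s * r1 s)) in
  let L3 s := e1%:R * r1 s ^+ 2 + e2%:R * r2 s ^+ 2 + 2 * (h3 * (r1 s * r2 s)) in
  let th s := b1 * angle ((L2 s + L3 s - L1 s) / 2) (L2 s * L3 s)
    + b2 * angle ((L3 s + L1 s - L2 s) / 2) (L3 s * L1 s)
    + b3 * angle ((L1 s + L2 s - L3 s) / 2) (L1 s * L2 s) in
  ((L1 0 + L2 0 - L3 0) / 2) ^+ 2 < L1 0 * L2 0 -> is_true (th 1 < th 0).
Proof.
move=> p1 p2 p3 d1 d2 d3 g1 g2 g3 nz L1 L2 L3 th D0.
pose dL1 s := 2 * (e2%:R * r2 s ^+ 2 + h1 * (r2 s * r3 s)) * b2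
            + 2 * (e3%:R * r3 s ^+ 2 + h1 * (r2 s * r3 s)) * b3.
pose dL2 s := 2 * (e3%:R * r3 s ^+ 2 + h2 * (r3 s * r1 s)) * b3
            + 2 * (e1%:R * r1 s ^+ 2 + h2 * (r3 s * r1 s)) * b1.
pose dL3 s := 2 * (e1%:R * r1 s ^+ 2 + h3 * (r1 s * r2 s)) * b1
            + 2 * (e2%:R * r2 s ^+ 2 + h3 * (r1 s * r2 s)) * b2.
have dL (e e' : bool) (h b b' : R) (r r' : R -> R) (s : R) :
    euc_path b r -> euc_path b' r' -> 0 <= s <= 1 ->
    is_derive s 1 (fun t => e%:R * r t ^+ 2 + e'%:R * r' t ^+ 2 + 2 * (h * (r t * r' t)))
      (2 * (e%:R * r s ^+ 2 + h * (r s * r' s)) * b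
       + 2 * (e'%:R * r' s ^+ 2 + h * (r s * r' s)) * b').
  move=> H H' hs; have [dr _] := H _ hs; have [dr' _] := H' _ hs.
  have -> : (fun t => e%:R * r t ^+ 2 + e'%:R * r' t ^+ 2 + 2 * (h * (r t * r' t))) =
    e%:R *: (r * r) + e'%:R *: (r' * r') + 2 *: (h *: (r * r')).
    by apply/funext => t; rewrite !expr2.
  apply: is_derive_eq (is_deriveD (is_deriveD (is_deriveZ e%:R (is_deriveM dr dr))
    (is_deriveZ e'%:R (is_deriveM dr' dr')))
    (is_deriveZ 2 (is_deriveZ h (is_deriveM dr dr')))) _.
  by rewrite /GRing.scale/=; ring.
have dP (f f' f'' : R -> R) (df df' df'' s : R) : is_derive s 1 f df ->
    is_derive s 1 f' df' -> is_derive s 1 f'' df'' ->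
    is_derive s 1 (fun t => (f t + f' t - f'' t) / 2) ((df + df' - df'') / 2).
  move=> k k' k''; apply: (is_derive_eq
    (is_deriveM (is_deriveB (is_deriveD k k') k'') (is_derive_cst (2^-1 : R) s 1))).
  by rewrite /GRing.scale/=; ring.
have L0 (s : R) : 0 <= s <= 1 -> [/\ 0 < L1 s, 0 < L2 s & 0 < L3 s].
  move=> hs; have [_ r1p] := p1 _ hs; have [_ r2p] := p2 _ hs; have [_ r3p] := p3 _ hs.
  by split; exact: edge_length_gt0.
apply: (@triangle_angle_mono R (fun s => (L2 s + L3 s - L1 s) / 2)
  (fun s => (L3 s + L1 s - L2 s) / 2) (fun s => (L1 s + L2 s - L3 s) / 2)
  L1 L2 L3
  (fun s => (dL2 s + dL3 s - dL1 s) / 2)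
  (fun s => (dL3 s + dL1 s - dL2 s) / 2)
  (fun s => (dL1 s + dL2 s - dL3 s) / 2) dL1 dL2 dL3
  b1 b2 b3) => [s hs|s hs|s hs|s hs|s hs|].
- have k1 := dL e2 e3 h1 _ _ _ _ _ p2 p3 hs.
  have k2 := dL e3 e1 h2 _ _ _ _ _ p3 p1 hs.
  have k3 := dL e1 e2 h3 _ _ _ _ _ p1 p2 hs.
  by split; split; [exact: dP|exact: dP|exact: dP| | |].
- exact: L0.
- by field.
- by field.
- have [L1p L2p L3p] := L0 _ hs; rewrite subr_gt0 => Ds.
  rewrite /dL1 /dL2 /dL3 euc_angle_speed ?lt0r_neq0//.
  have [_ r1p] := p1 _ hs; have [_ r2p] := p2 _ hs; have [_ r3p] := p3 _ hs.
  exact: euc_form_gt0.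
- by rewrite subr_gt0.
Qed.

(** * Comparison of two conformal factors on one face *)

Lemma sqr_expR (x : R) : expR (2 * x) = expR x ^+ 2.
Proof. by rewrite expr2 -expRD -mulr2n mulr_natl. Qed.

Lemma conf_length_euclidean (e e' : bool) (h f f' : R) :
  conf_length Euclidean e e' h f f' =
  Num.sqrt (e%:R * expR f ^+ 2 + e'%:R * expR f' ^+ 2 + 2 * (h * (expR f * expR f'))).
Proof. by rewrite /conf_length !sqr_expR expRD !mulrA. Qed.

Lemma conf_length_hyperbolic (e e' : bool) (h f f' : R) :
  conf_length Hyperbolic e e' h f f' =
  arcosh (coshr Hyperbolic e (ucoord Hyperbolic e f)
          * coshr Hyperbolic e' (ucoord Hyperbolic e' f')
          + h * (expR f * expR f')).
Proof.
have q (e0 : bool) (f0 : R) : 1 + e0%:R * expR (2 * f0) = coshr Hyperbolic e0 (ucoord Hyperbolic e0 f0) ^+ 2.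
  by rewrite sqr_coshr ?ucoord_domain// radius_ucoord sqr_expR.
rewrite /conf_length expRD !q -exprMn sqrtr_sqr ger0_norm// ltW// mulr_gt0//;
  exact/coshr_gt0/ucoord_domain.
Qed.

(** A Euclidean velocity with equal entries only rescales the triangle, so it counts as trivial. *)
Definition nontrivial (g : geometry) (b1 b2 b3 : R) : bool :=
  if g is Hyperbolic then (b1, b2, b3) != (0, 0, 0) else (b2 - b3, b3 - b1) != (0, 0).

Definition face_sum (g : geometry) (b1 b2 b3 l1 l2 l3 : R) : R :=
  b1 * inner_angle g l3 l2 l1 + b2 * inner_angle g l1 l3 l2
  + b3 * inner_angle g l2 l1 l3.

Definition strict_triangle (l1 l2 l3 : R) :=
  [/\ l1 < l2 + l3, l2 < l3 + l1 & l3 < l1 + l2].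

Lemma udomain_path g e (f f' s : R) : 0 <= s <= 1 ->
  udomain g e (ucoord g e f + s * (ucoord g e f' - ucoord g e f)).
Proof.
move=> /andP[s0 s1]; have := ucoord_domain g e f; have := ucoord_domain g e f'.
case: g => //=; case: e => //=.
set u := - ln _; set u' := - ln _ => u0 u0'; nra.
Qed.

Lemma hyp_path_ucoord e (f f' : R) :
  let u := ucoord Hyperbolic e f in let b := ucoord Hyperbolic e f' - u in
  hyp_path e b (fun s => radius Hyperbolic e (u + s * b))
    (fun s => coshr Hyperbolic e (u + s * b)).
Proof.
move=> u b s hs; have ud := udomain_path Hyperbolic e f f' hs.
split; [exact: is_derive_radius|exact: is_derive_coshr|exact: radius_gt0|exact: coshr_gt0|].
exact: sqr_coshr.
Qed.

Lemma euc_path_ucoord (f f' : R) : euc_path (f' - f) (fun s => expR (f + s * (f' - f))).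
Proof.
move=> s _; split; last exact: expR_gt0.
by have := @is_derive_radius Euclidean true f (f' - f) s isT; rewrite /= mulr1.
Qed.

Lemma face_sum_hyperbolic (c1 c2 c3 b1 b2 b3 : R) : 1 < c1 -> 1 < c2 -> 1 < c3 ->
  0 < cosh_gram_det c1 c2 c3 ->
  face_sum Hyperbolic b1 b2 b3 (arcosh c1) (arcosh c2) (arcosh c3) =
  b1 * angle (c2 * c3 - c1) ((c2 ^+ 2 - 1) * (c3 ^+ 2 - 1))
    + b2 * angle (c3 * c1 - c2) ((c3 ^+ 2 - 1) * (c1 ^+ 2 - 1))
    + b3 * angle (c1 * c2 - c3) ((c1 ^+ 2 - 1) * (c2 ^+ 2 - 1)).
Proof.
move=> h1 h2 h3; rewrite /cosh_gram_det => D0; rewrite /face_sum.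
by rewrite !inner_angle_hyperbolic//; lra.
Qed.

Lemma face_sum_euclidean (L1 L2 L3 b1 b2 b3 : R) : 0 < L1 -> 0 < L2 -> 0 < L3 ->
  ((L1 + L2 - L3) / 2) ^+ 2 < L1 * L2 ->
  face_sum Euclidean b1 b2 b3 (Num.sqrt L1) (Num.sqrt L2) (Num.sqrt L3) =
  b1 * angle ((L2 + L3 - L1) / 2) (L2 * L3) + b2 * angle ((L3 + L1 - L2) / 2) (L3 * L1)
    + b3 * angle ((L1 + L2 - L3) / 2) (L1 * L2).
Proof.
move=> h1 h2 h3 D0; rewrite /face_sum.
have e (L : R) : 0 < L -> Num.sqrt L ^+ 2 = L by move=> L0; rewrite sqr_sqrtr ?ltW.
rewrite !inner_angle_euclidean ?sqrtr_gt0 ?sqrtr_ge0 ?e//; try lra.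
by rewrite (addrC L3 L2) (addrC L1 L3) (addrC L2 L1) (mulrC L3 L2) (mulrC L1 L3) (mulrC L2 L1).
Qed.

Lemma angleZ (k p q : R) : 0 < k -> angle (k * p) (k ^+ 2 * q) = angle p q.
Proof.
move=> k0; rewrite /angle sqrtrM ?sqr_ge0// sqrtr_sqr gtr0_norm//.
by rewrite -mulf_div divff ?mul1r// lt0r_neq0.
Qed.

Lemma sqrt_nondegenerate (x y z : R) : 0 < x -> 0 < y -> 0 < z ->
  strict_triangle (Num.sqrt x) (Num.sqrt y) (Num.sqrt z) ->
  ((x + y - z) / 2) ^+ 2 < x * y.
Proof.
move=> x0 y0 z0 [k1 k2 k3].
have := @euclidean_nondegenerate (Num.sqrt x) (Num.sqrt y) (Num.sqrt z).
by rewrite !sqrtr_gt0 !sqr_sqrtr ?ltW//; apply.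
Qed.

(** A trivial hyperbolic velocity is 0, so both sums vanish. A trivial Euclidean one multiplies all
    lengths by [expR b1], and the angles are scale invariant. *)
Lemma face_angles_eq g (e1 e2 e3 : bool) (h1 h2 h3 f1 f2 f3 f1' f2' f3' : R) :
  0 < e2%:R * e3%:R + h1 -> 0 < e3%:R * e1%:R + h2 -> 0 < e1%:R * e2%:R + h3 ->
  let l1 := conf_length g e2 e3 h1 f2 f3 in
  let l2 := conf_length g e3 e1 h2 f3 f1 in
  let l3 := conf_length g e1 e2 h3 f1 f2 in
  let l1' := conf_length g e2 e3 h1 f2' f3' in
  let l2' := conf_length g e3 e1 h2 f3' f1' in
  let l3' := conf_length g e1 e2 h3 f1' f2' in
  let b1 := ucoord g e1 f1' - ucoord g e1 f1 in
  let b2 := ucoord g e2 f2' - ucoord g e2 f2 in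
  let b3 := ucoord g e3 f3' - ucoord g e3 f3 in
  strict_triangle l1 l2 l3 -> strict_triangle l1' l2' l3' ->
  ~~ nontrivial g b1 b2 b3 ->
  face_sum g b1 b2 b3 l1' l2' l3' = face_sum g b1 b2 b3 l1 l2 l3.
Proof.
move=> d1 d2 d3; case: g => l1 l2 l3 l1' l2' l3' b1 b2 b3 t t'; last first.
  by clearbody b1 b2 b3 => /negPn/eqP[-> -> ->]; rewrite /face_sum !mul0r.
move=> /negPn/eqP[b23 b31].
have L1 := edge_length_gt0 (expR_gt0 f2) (expR_gt0 f3) d1.
have L2 := edge_length_gt0 (expR_gt0 f3) (expR_gt0 f1) d2.
have L3 := edge_length_gt0 (expR_gt0 f1) (expR_gt0 f2) d3.
have L1' := edge_length_gt0 (expR_gt0 f2') (expR_gt0 f3') d1.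
have L2' := edge_length_gt0 (expR_gt0 f3') (expR_gt0 f1') d2.
have L3' := edge_length_gt0 (expR_gt0 f1') (expR_gt0 f2') d3.
rewrite /l1 /l2 /l3 !conf_length_euclidean in t *.
rewrite /l1' /l2' /l3' !conf_length_euclidean in t' *.
have D := sqrt_nondegenerate L1 L2 L3 t; have D' := sqrt_nondegenerate L1' L2' L3' t'.
rewrite !face_sum_euclidean// {l1 l2 l3 l1' l2' l3' t t' D D' L1 L2 L3 L1' L2' L3'}.
have e1' : f1' = b1 + f1 by rewrite /b1 /= subrK.
have e2' : f2' = b1 + f2 by move: b23 b31; rewrite /b1 /b2 /b3 /=; lra.
have e3' : f3' = b1 + f3 by move: b23 b31; rewrite /b1 /b2 /b3 /=; lra.
clearbody b1 b2 b3; rewrite e1' e2' e3' !expRD; have k0 := expR_gt0 b1; move: k0; set k := expR b1 => k0.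
have kk : 0 < k ^+ 2 by rewrite exprn_gt0.
have sc (e e' : bool) (h x y : R) :
    e%:R * (k * x) ^+ 2 + e'%:R * (k * y) ^+ 2 + 2 * (h * (k * x * (k * y))) =
    k ^+ 2 * (e%:R * x ^+ 2 + e'%:R * y ^+ 2 + 2 * (h * (x * y))) by ring.
rewrite !sc; set M1 := e2%:R * _ + _ + _; set M2 := e3%:R * _ + _ + _.
set M3 := e1%:R * _ + _ + _.
have P x y z : (k ^+ 2 * x + k ^+ 2 * y - k ^+ 2 * z) / 2 = k ^+ 2 * ((x + y - z) / 2).
  by field.
have Q x y : k ^+ 2 * x * (k ^+ 2 * y) = (k ^+ 2) ^+ 2 * (x * y) by ring.
by rewrite !P !Q !angleZ.
Qed.

(** The monotonicity along the segment is read at its ends, where nondegeneracy identifies the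
    continued angles with the inner angles. *)
Lemma face_angles_lt g (e1 e2 e3 : bool) (h1 h2 h3 f1 f2 f3 f1' f2' f3' : R) :
  0 < e2%:R * e3%:R + h1 -> 0 < e3%:R * e1%:R + h2 -> 0 < e1%:R * e2%:R + h3 ->
  0 <= e1%:R * h1 + h2 * h3 -> 0 <= e2%:R * h2 + h3 * h1 ->
  0 <= e3%:R * h3 + h1 * h2 ->
  let l1 := conf_length g e2 e3 h1 f2 f3 in
  let l2 := conf_length g e3 e1 h2 f3 f1 in
  let l3 := conf_length g e1 e2 h3 f1 f2 in
  let l1' := conf_length g e2 e3 h1 f2' f3' in
  let l2' := conf_length g e3 e1 h2 f3' f1' in
  let l3' := conf_length g e1 e2 h3 f1' f2' in
  let b1 := ucoord g e1 f1' - ucoord g e1 f1 in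
  let b2 := ucoord g e2 f2' - ucoord g e2 f2 in
  let b3 := ucoord g e3 f3' - ucoord g e3 f3 in
  strict_triangle l1 l2 l3 -> strict_triangle l1' l2' l3' -> nontrivial g b1 b2 b3 ->
  face_sum g b1 b2 b3 l1' l2' l3' < face_sum g b1 b2 b3 l1 l2 l3.
Proof.
move=> d1 d2 d3 g1 g2 g3; case: g => l1 l2 l3 l1' l2' l3' b1 b2 b3 t t' nz.
  have p1 := euc_path_ucoord f1 f1'; have p2 := euc_path_ucoord f2 f2'.
  have p3 := euc_path_ucoord f3 f3'.
  have := euc_triangle_mono p1 p2 p3 d1 d2 d3 g1 g2 g3 nz.
  rewrite /= !mul0r !addr0 !mul1r ![_ + (_ - _)]addrC !subrK.
  have L1 := edge_length_gt0 (expR_gt0 f2) (expR_gt0 f3) d1.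
  have L2 := edge_length_gt0 (expR_gt0 f3) (expR_gt0 f1) d2.
  have L3 := edge_length_gt0 (expR_gt0 f1) (expR_gt0 f2) d3.
  have L1' := edge_length_gt0 (expR_gt0 f2') (expR_gt0 f3') d1.
  have L2' := edge_length_gt0 (expR_gt0 f3') (expR_gt0 f1') d2.
  have L3' := edge_length_gt0 (expR_gt0 f1') (expR_gt0 f2') d3.
  rewrite /l1 /l2 /l3 !conf_length_euclidean in t *.
  rewrite /l1' /l2' /l3' !conf_length_euclidean in t' *.
  have D := sqrt_nondegenerate L1 L2 L3 t; have D' := sqrt_nondegenerate L1' L2' L3' t'.
  by move=> /(_ D); rewrite !face_sum_euclidean.
have p1 := hyp_path_ucoord e1 f1 f1'; have p2 := hyp_path_ucoord e2 f2 f2'.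
have p3 := hyp_path_ucoord e3 f3 f3'.
have := hyp_triangle_mono p1 p2 p3 d1 d2 d3 g1 g2 g3 nz.
cbv zeta beta; rewrite !mul0r !addr0 !mul1r ![_ + (_ - _)]addrC !subrK !radius_ucoord.
have gt1 (e e' : bool) (h f f' : R) : 0 < e%:R * e'%:R + h ->
    1 < coshr Hyperbolic e (ucoord Hyperbolic e f)
      * coshr Hyperbolic e' (ucoord Hyperbolic e' f') + h * (expR f * expR f').
  move=> d; have ud := ucoord_domain Hyperbolic e f.
  have ud' := ucoord_domain Hyperbolic e' f'.
  have := edge_cosh_gt1 (radius_gt0 ud) (radius_gt0 ud') (coshr_gt0 ud) (coshr_gt0 ud')
    (sqr_coshr ud) (sqr_coshr ud') d.
  by rewrite !radius_ucoord.
rewrite /l1 /l2 /l3 !conf_length_hyperbolic in t *.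
rewrite /l1' /l2' /l3' !conf_length_hyperbolic in t' *.
have k1 := gt1 e2 e3 h1 f2 f3 d1; have k2 := gt1 e3 e1 h2 f3 f1 d2.
have k3 := gt1 e1 e2 h3 f1 f2 d3.
have k1' := gt1 e2 e3 h1 f2' f3' d1; have k2' := gt1 e3 e1 h2 f3' f1' d2.
have k3' := gt1 e1 e2 h3 f1' f2' d3.
have [t1 t2 t3] := t; have [t1' t2' t3'] := t'.
have D := hyperbolic_nondegenerate k1 k2 k3 t1 t2 t3.
have D' := hyperbolic_nondegenerate k1' k2' k3' t1' t2' t3'.
by move=> /(_ D); rewrite !face_sum_hyperbolic.
Qed.

End TriangleAngles.

(** * Summation over the surface *)

Section Surface.
Variables (R : realType) (S : triangulated_surface).

Lemma vertex_ofP (v : vertex S) : exists x : corner S, vertex_of x = v.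
Proof. by exists (generic_quotient.repr v); exact: reprK. Qed.

(* The quotient [vertex S] carries no finType structure, hence the sum over the
   corners is partitioned by the representatives of their vertices. *)
Lemma sum_corners (b : vertex S -> R) (th th' : corner S -> R) :
  (forall v, \sum_(x | vertex_of x == v) th x = \sum_(x | vertex_of x == v) th' x) ->
  \sum_(x : corner S) b (vertex_of x) * (th' x - th x) = 0.
Proof.
move=> E; pose h (x : corner S) := generic_quotient.repr (vertex_of x).
rewrite (partition_big h (fun y => h y == y)) => [|x _]; last first.
  by rewrite /h /vertex_of reprK.
apply: big1 => y /eqP hy.
have c x : (h x == y) = (vertex_of x == vertex_of y).
  apply/eqP/eqP => [<-|xy]; first by rewrite /h /vertex_of reprK.
  by rewrite -hy /h xy.
rewrite (eq_bigl _ _ c).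
under eq_bigr => x /eqP-> do [].
by rewrite -mulr_sumr sumrB -E subrr mulr0.
Qed.

Lemma sum_ord3 (F : 'I_3 -> R) : \sum_(a < 3) F a = F 0 + F 1 + F 2.
Proof.
rewrite !big_ord_recl big_ord0 addr0 addrA.
by congr (F _ + F _ + F _); apply/val_inj.
Qed.

Variables (eps : vertex S -> bool) (eta : edge S -> R).
Hypothesis Hedge : forall (t : face S) (q s u : 'I_3), uniq [:: q; s; u] ->
      0 < (eps (vertex_of (t, s)))%:R * (eps (vertex_of (t, u)))%:R
          + eta (edge_of (t, q)).
Hypothesis Hface : forall (t : face S) (q s u : 'I_3), uniq [:: q; s; u] ->
      0 <= (eps (vertex_of (t, q)))%:R * eta (edge_of (t, q))
           + eta (edge_of (t, u)) * eta (edge_of (t, s)).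

Lemma ord3_cycle :
  (((0 : 'I_3) + 1 = 1)%R * ((0 : 'I_3) + 2 = 2)%R * ((1 : 'I_3) + 1 = 2)%R
  * ((1 : 'I_3) + 2 = 0)%R * ((2 : 'I_3) + 1 = 0)%R * ((2 : 'I_3) + 2 = 1)%R)%type.
Proof. by do !split; apply/val_inj. Qed.

Lemma nondegenerate_face g f (t : face S) : nondegenerate_factor eps eta g f ->
  strict_triangle (side_length eps eta g f (t, 0)) (side_length eps eta g f (t, 1))
    (side_length eps eta g f (t, 2)).
Proof.
move=> H; split; [have := H t 0|have := H t 1|have := H t 2]; by rewrite !ord3_cycle.
Qed.

(** The differences [D] of the face sums are nonnegative, and positive on nontrivial faces, while
    equal curvatures make their total vanish. *)
Lemma face_trivial g f f' : nondegenerate_factor eps eta g f ->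
  nondegenerate_factor eps eta g f' ->
  curvature eps eta g f =1 curvature eps eta g f' ->
  let b v := ucoord g (eps v) (f' v) - ucoord g (eps v) (f v) in
  forall t, ~~ nontrivial g (b (vertex_of (t, 0))) (b (vertex_of (t, 1))) (b (vertex_of (t, 2))).
Proof.
move=> nf nf' K b t.
have angles v : \sum_(x | vertex_of x == v) corner_angle eps eta g f x =
    \sum_(x | vertex_of x == v) corner_angle eps eta g f' x.
  by have := K v; rewrite /curvature => /addrI/oppr_inj.
have fsum f0 u : \sum_(a < 3) b (vertex_of (u, a)) * corner_angle eps eta g f0 (u, a) =
  face_sum g (b (vertex_of (u, 0))) (b (vertex_of (u, 1))) (b (vertex_of (u, 2)))
   (side_length eps eta g f0 (u, 0)) (side_length eps eta g f0 (u, 1)) (side_length eps eta g f0 (u, 2)).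
  by rewrite sum_ord3 /corner_angle /= !ord3_cycle.
pose D u := \sum_(a < 3) b (vertex_of (u, a)) *
  (corner_angle eps eta g f (u, a) - corner_angle eps eta g f' (u, a)).
have De u : D u = face_sum g (b (vertex_of (u, 0))) (b (vertex_of (u, 1))) (b (vertex_of (u, 2)))
     (side_length eps eta g f (u, 0)) (side_length eps eta g f (u, 1)) (side_length eps eta g f (u, 2))
   - face_sum g (b (vertex_of (u, 0))) (b (vertex_of (u, 1))) (b (vertex_of (u, 2)))
     (side_length eps eta g f' (u, 0)) (side_length eps eta g f' (u, 1)) (side_length eps eta g f' (u, 2)).
  by rewrite /D; under eq_bigr do rewrite mulrBr; rewrite sumrB !fsum.
have lt u : nontrivial g (b (vertex_of (u, 0))) (b (vertex_of (u, 1))) (b (vertex_of (u, 2))) -> 0 < D u.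
  move=> nz; rewrite De subr_gt0.
  have := nondegenerate_face u nf; have := nondegenerate_face u nf'.
  rewrite /side_length /= !ord3_cycle => t' t0.
  apply: face_angles_lt => //; first [exact: Hedge | exact: Hface].
have ge u : 0 <= D u.
  case: (boolP (nontrivial g (b (vertex_of (u, 0))) (b (vertex_of (u, 1))) (b (vertex_of (u, 2))))) => [/lt/ltW//|nz].
  rewrite De subr_ge0.
  have := nondegenerate_face u nf; have := nondegenerate_face u nf'.
  rewrite /side_length /= !ord3_cycle => t' t0.
  by rewrite (face_angles_eq _ _ _ t0 t' nz)//; exact: Hedge.
have s0 : \sum_(u : face S) D u = 0.
  rewrite /D pair_big/= -[RHS](sum_corners b (fun v => esym (angles v))).
  by apply: eq_bigr => -[].
apply/negP => /lt; rewrite lt_neqAle => /andP[/negP + _]; apply; apply/eqP/esym.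
by apply: (psumr_eq0P _ s0) => //.
Qed.

End Surface.

Theorem theorem1p5 (R : realType) (S : triangulated_surface)
    (eps : vertex S -> bool) (eta : edge S -> R)
    (Sconn : connected_surface S)
    (Hedge : forall (t : face S) (q s u : 'I_3), uniq [:: q; s; u] ->
      0 < (eps (vertex_of (t, s)))%:R * (eps (vertex_of (t, u)))%:R
          + eta (edge_of (t, q)))
    (Hface : forall (t : face S) (q s u : 'I_3), uniq [:: q; s; u] ->
      0 <= (eps (vertex_of (t, q)))%:R * eta (edge_of (t, q))
           + eta (edge_of (t, u)) * eta (edge_of (t, s))) :
  (forall f f' : vertex S -> R,
     nondegenerate_factor eps eta Euclidean f ->
     nondegenerate_factor eps eta Euclidean f' ->
     curvature eps eta Euclidean f =1 curvature eps eta Euclidean f' ->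
     exists c : R, forall v : vertex S, f v - f' v = c)
  /\
  (forall f f' : vertex S -> R,
     nondegenerate_factor eps eta Hyperbolic f ->
     nondegenerate_factor eps eta Hyperbolic f' ->
     curvature eps eta Hyperbolic f =1 curvature eps eta Hyperbolic f' ->
     f =1 f').
Proof.
have I3 (a : 'I_3) : [\/ a = 0, a = 1 | a = 2].
  by case: a => -[|[|[|//]]] i; [apply: Or31|apply: Or32|apply: Or33]; apply/val_inj.
split=> f f' nf nf' K; have H := face_trivial Hedge Hface nf nf' K; last first.
  (* Every vertex is a corner of some face, where the two values of [u] agree; [ucoord] is
     injective. *)
  move=> v; have [[t a] <-] := vertex_ofP v; move: (H t) => /negPn/eqP[e0 e1 e2].
  apply/esym/(@ucoord_inj R Hyperbolic (eps (vertex_of (t, a))))/eqP; rewrite -subr_eq0.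
  by have [->|->|->] := I3 a; apply/eqP.
pose b (t : face S) (a : 'I_3) := f (vertex_of (t, a)) - f' (vertex_of (t, a)).
have bc t a a' : b t a = b t a'.
  rewrite /b; move: (H t) => /negPn/eqP[/= e0 e1].
  by have [->|->|->] := I3 a; have [->|->|->] := I3 a'; lra.
(* The corner [a + 1] is an endpoint of the side opposite to [a], hence shares its vertex with a
   corner of the adjacent face, and the constants of the two faces agree there. *)
have badj t a : b (adj (t, a)) 0 = b t 0.
  have aa : a + 1 != a by apply/eqP/eqP; case: a => -[|[|[|//]]] i.
  rewrite (bc _ _ (gperm (t, a) (a + 1))) (bc t _ (a + 1)) /b.
  suff -> : vertex_of (adj (t, a), gperm (t, a) (a + 1)) = vertex_of (t, a + 1) by [].
  apply/eqmodP; rewrite /= corner_rel_sym; apply: connect1; apply/existsP; exists a.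
  by rewrite eq_sym aa eqxx.
have [/card_gt0P[t0 _] conn] := Sconn.
have bt t : b t 0 = b t0 0.
  have /connectP[p + ->] := conn t0 t.
  elim: p t0 {conn} => //= u p IH t1 /andP[/existsP[a /eqP ua] /IH ->].
  by rewrite ua badj.
exists (b t0 0) => v; have [[t a] <-] := vertex_ofP v.
by rewrite -(bt t) (bc t 0 a).
Qed.
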